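(* Let $A$ be the completed free graded Lie algebra over $\mathbf{Q}$ on generators $a$, $b$, $e$ of degrees $-1$, $-1$ and $0$ respectively. Then there is exactly one differential $\partial$ on $A$ making $(A,[\cdot,\cdot],\partial)$ a differential graded Lie algebra (in particular $\partial$ is a degree $-1$ derivation with $\partial^2=0$) such that $a$ and $b$ are flat, i.e. $\partial a+\tfrac12[a,a]=0$ and $\partial b+\tfrac12[b,b]=0$, and the flow generated by $e$ moves $a$ to $b$ in unit time. This differential is specified by $\partial a=-\tfrac12[a,a]$, $\partial b=-\tfrac12[b,b]$ and $$\partial e=(\mathrm{ad}_e)b+\sum_{i=0}^\infty\frac{B_i}{i!}(\mathrm{ad}_e)^i(b-a),$$ where the $B_i$ are the Bernoulli numbers defined by $\frac{x}{e^x-1}=\sum_{n=0}^\infty B_n\frac{x^n}{n!}$ (in this last formula $e^x$ is the exponential series in the formal variable $x$).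
   Context: All vector spaces are over $\mathbf{Q}$. A differential graded Lie algebra (DGLA) is a $\mathbb{Z}$-graded vector space $A=\bigoplus_n A_n$ with a bilinear bracket satisfying $|[x,y]|=|x|+|y|$ and a linear map $\partial$ of degree $-1$ with $\partial^2=0$, such that for homogeneous $x,y,z$: (1) $[y,x]=-(-1)^{|x||y|}[x,y]$; (2) $[[x,y],z]=[x,[y,z]]-(-1)^{|x||y|}[y,[x,z]]$; (3) $\partial[x,y]=[\partial x,y]+(-1)^{|x|}[x,\partial y]$. A graded Lie algebra has only the bracket, satisfying (1) and (2). Write $\mathrm{ad}_x(y)=[x,y]$. Completion: let $L$ be the free graded Lie algebra on $a,b,e$, and let $L^{(n)}$ be the finite-dimensional span of all words involving exactly $n$ brackets, so $L=\bigoplus_{n\ge0}L^{(n)}$. The completed free graded Lie algebra $A$ has degree-$d$ part $A_d=\prod_{n\ge 0}L^{(n)}_d$, with the bracket extended in the obvious way; infinite sums are understood with respect to the number of brackets. For $N\ge0$, let $B^{(N)}$ be the quotient of $A$ by all elements involving only terms with more than $N$ brackets. Any derivation $\partial$ as in (3) does not decrease the number of brackets, is determined by its values on the generators, and induces a derivation on each $B^{(N)}$. Flow: for $v\in A_0$ and $x_0\in A_{-1}$, for each $N$ there is a unique $u(t)\in B^{(N)}\otimes\mathbf{Q}[t]$ with $u(0)=x_0$ and $$\frac{du}{dt}=\partial v-\mathrm{ad}_v(u),$$ and these solutions are compatible as $N$ varies. The flow generated by $v$ is said to move $x_0$ to $y\in A_{-1}$ in unit time if $u(1)=y$ in $B^{(N)}$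 for every $N$. *)

(* Defs.v *)
From HB Require Import structures.
From mathcomp Require Import all_boot all_order all_algebra.
From mathcomp Require Import generic_quotient ring_quotient.
From mathcomp.classical Require Import boolp functions.
From mathcomp.multinomials Require Import freeg.

Set Implicit Arguments.
Unset Strict Implicit.
Unset Printing Implicit Defensive.

Import GRing.Theory Num.Theory.
Local Open Scope ring_scope.
Local Open Scope quotient_scope.

Fact linear_eq0 (U V : lmodType rat) (f : U -> V) : linear f -> f 0 = 0.
Proof. by move=> fL; have := fL (-1) 0 0; rewrite scaler0 addr0 scaleN1r addNr. Qed.

Inductive spanned (V : lmodType rat) (P : V -> Prop) : V -> Prop :=
| Spanned_gen x of P x : spanned P x
| Spanned0 : spanned P 0
| SpannedP k x y of spanned P x & spanned P y : spanned P (k *: x + y).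

Definition span (V : lmodType rat) (P : V -> Prop) : {pred V} :=
  fun x => `[< spanned P x >].

Section Span.
Variables (V : lmodType rat) (P : V -> Prop).

Lemma spanP x : reflect (spanned P x) (x \in span P).
Proof. exact: asboolP. Qed.

Fact span_submod_closed : submod_closed (span P).
Proof.
split; first by apply/spanP; exact: Spanned0.
by move=> k x y /spanP Px /spanP Py; apply/spanP; exact: SpannedP.
Qed.

HB.instance Definition _ :=
  GRing.isSubmodClosed.Build rat V (span P) span_submod_closed.

End Span.

(* The quotient of V by the subspace spanned by P; the library only makes it  *)
(* a zmodType.                                                                *)
Definition vquot (V : lmodType rat) (P : V -> Prop) : Type :=
  {ideal_quot (span P)}.

Section Vquot.
Variables (V : lmodType rat) (P : V -> Prop).

HB.instance Definition _ := GRing.Zmodule.on (vquot P).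
HB.instance Definition _ := EqQuotient.on (vquot P).

Definition vpi (x : V) : vquot P := \pi_(vquot P) x.
Definition vrepr (x : vquot P) : V := repr x.

Lemma vreprK : cancel vrepr vpi.
Proof. exact: reprK. Qed.

Lemma vpi_eq x y : vpi x = vpi y <-> x - y \in span P.
Proof. by rewrite Quotient.idealrBE; split=> /eqP. Qed.

Fact vpiB : zmod_morphism vpi.
Proof. by move=> x y; rewrite /vpi !piE. Qed.

HB.instance Definition _ := GRing.isZmodMorphism.Build V (vquot P) vpi vpiB.

Definition vquot_scale (k : rat) (x : vquot P) : vquot P := vpi (k *: vrepr x).

Fact vquot_scale_pi k x : vquot_scale k (vpi x) = vpi (k *: x).
Proof.
by apply/vpi_eq; rewrite -scalerBr rpredZ //; apply/vpi_eq; rewrite vreprK.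
Qed.

Fact vquot_scaleA k l x :
  vquot_scale k (vquot_scale l x) = vquot_scale (k * l) x.
Proof. by rewrite -[x]vreprK !vquot_scale_pi scalerA. Qed.

Fact vquot_scale1 : left_id 1 vquot_scale.
Proof. by move=> x; rewrite -[x]vreprK vquot_scale_pi scale1r. Qed.

Fact vquot_scaleDr : right_distributive vquot_scale +%R.
Proof.
move=> k x y; rewrite -[x]vreprK -[y]vreprK -raddfD !vquot_scale_pi.
by rewrite scalerDr raddfD.
Qed.

Fact vquot_scaleDl x : {morph vquot_scale^~ x : k l / k + l}.
Proof. by move=> k l; rewrite -[x]vreprK !vquot_scale_pi scalerDl raddfD. Qed.

HB.instance Definition _ := GRing.Zmodule_isLmodule.Build rat (vquot P)
  vquot_scaleA vquot_scale1 vquot_scaleDr vquot_scaleDl.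

Fact vpiZ : scalable vpi.
Proof. by move=> k x; rewrite -vquot_scale_pi. Qed.

HB.instance Definition _ := GRing.isScalable.Build rat V (vquot P) *:%R vpi vpiZ.

End Vquot.

Arguments vpi {V} P x.

(* A grading of V is given by its homogeneous subspaces: deg n x means that x *)
(* is in V_n.                                                                 *)
Section DGLA.
Variables (V : lmodType rat) (deg : int -> V -> Prop) (br : V -> V -> V).

Record is_grading : Prop := IsGrading {
  grading0 : forall n, deg n 0;
  gradingP : forall n k x y, deg n x -> deg n y -> deg n (k *: x + y);
  grading_sum : forall x, exists (s : seq int) (c : int -> V),
    (forall n, deg n (c n)) /\ x = \sum_(n <- s) c n;
  grading_direct : forall (s : seq int) (c : int -> V), uniq s ->
    (forall n, deg n (c n)) -> \sum_(n <- s) c n = 0 ->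
    forall n, n \in s -> c n = 0 }.

Definition koszul (m n : int) : rat := (-1) ^ (m * n).

Record is_graded_lie : Prop := IsGradedLie {
  lie_grading : is_grading;
  lie_linear_l : forall y, linear (br ^~ y);
  lie_linear_r : forall x, linear (br x);
  lie_deg : forall m n x y, deg m x -> deg n y -> deg (m + n) (br x y);
  lie_antisym : forall m n x y, deg m x -> deg n y ->
    br y x = - (koszul m n *: br x y);
  lie_jacobi : forall m n p x y z, deg m x -> deg n y -> deg p z ->
    br (br x y) z = br x (br y z) - koszul m n *: br y (br x z) }.

Record is_derivation (d : V -> V) : Prop := IsDerivation {
  der_linear : linear d;
  der_deg : forall n x, deg n x -> deg (n - 1) (d x);
  der_leibniz : forall m n x y, deg m x -> deg n y ->
    d (br x y) = br (d x) y + ((-1) ^ m : rat) *: br x (d y) }.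

Record is_dgla (d : V -> V) : Prop := IsDgla {
  dgla_lie : is_graded_lie;
  dgla_der : is_derivation d;
  dgla_square : forall x, d (d x) = 0 }.

Definition flat (d : V -> V) (x : V) : Prop :=
  d x + (1 / 2%:R : rat) *: br x x = 0.

End DGLA.

(* The free graded Lie algebra on a, b, e: the free non-associative algebra   *)
(* on these generators, modulo the ideal of graded Lie relations.             *)
Inductive gen := Gen_a | Gen_b | Gen_e.

Definition gen_deg (g : gen) : int := if g is Gen_e then 0 else -1.

Inductive word := Gen of gen | Br of word & word.

HB.instance Definition _ := gen_eqMixin word.
HB.instance Definition _ := gen_choiceMixin word.

Fixpoint word_deg (w : word) : int :=
  match w with Gen g => gen_deg g | Br s t => word_deg s + word_deg t end.

Fixpoint word_brackets (w : word) : nat :=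
  match w with
  | Gen _ => 0
  | Br s t => (word_brackets s + word_brackets t).+1
  end.

Definition free_alg : lmodType rat := {freeg word / rat}.

Definition free_word (w : word) : free_alg := << w >>.

Definition free_br (x y : free_alg) : free_alg :=
  fglift (fun s => fglift (fun t => free_word (Br s t)) y) x.

Section FreeBr.
Variables (M : lmodType rat) (f : word -> M).

Fact fglift_zmod_morphism : zmod_morphism (fglift f).
Proof. exact: lift_is_additive. Qed.

HB.instance Definition _ :=
  GRing.isZmodMorphism.Build free_alg M (fglift f) fglift_zmod_morphism.

Fact fglift_scalable : scalable (fglift f).
Proof.
move=> k x; rewrite -[x in RHS]freeg_sumE !raddf_sum /=.
by apply: eq_bigr => w _; rewrite !liftU scalerA.
Qed.

HB.instance Definition _ :=
  GRing.isScalable.Build rat free_alg M *:%R (fglift f) fglift_scalable.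

End FreeBr.

Fact free_br_linear_l y : linear (free_br ^~ y).
Proof. by move=> k x z; rewrite /free_br linearP. Qed.

Fact free_br_linear_r x : linear (free_br x).
Proof.
have brE u : free_br x u = \sum_(w <- dom x)
    coeff w x *: fglift (fun t => free_word (Br w t)) u.
  rewrite /free_br -[x in LHS]freeg_sumE raddf_sum /=.
  by apply: eq_bigr => w _; rewrite liftU.
move=> k y z; rewrite !brE scaler_sumr -big_split /=.
by apply: eq_bigr => w _; rewrite linearP scalerDr !scalerA mulrC.
Qed.

Fact free_br_word s t : free_br (free_word s) (free_word t) = free_word (Br s t).
Proof. by rewrite /free_br !liftU !scale1r. Qed.

Definition free_deg (n : int) (x : free_alg) : Prop :=
  spanned (fun x => exists2 w, word_deg w = n & x = free_word w) x.

Inductive lie_relator : free_alg -> Prop :=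
| Relator_antisym m n x y of free_deg m x & free_deg n y :
    lie_relator (free_br y x + koszul m n *: free_br x y)
| Relator_jacobi m n p x y z of free_deg m x & free_deg n y & free_deg p z :
    lie_relator (free_br (free_br x y) z
      - (free_br x (free_br y z) - koszul m n *: free_br y (free_br x z)))
| Relator_br_l x y of lie_relator x : lie_relator (free_br x y)
| Relator_br_r x y of lie_relator y : lie_relator (free_br x y).

Definition lie : lmodType rat := vquot lie_relator.

Definition lie_word (w : word) : lie := vpi lie_relator (free_word w).

Definition lie_br (x y : lie) : lie := vpi lie_relator (free_br (vrepr x) (vrepr y)).

(* The subspace of L^(n) of elements of degree d.                             *)
Definition lie_part (n : nat) (d : int) (x : lie) : Prop :=
  spanned (fun x => exists w,
    [/\ word_brackets w = n, word_deg w = d & x = lie_word w]) x.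

Fact lie_br_pi x y :
  lie_br (vpi lie_relator x) (vpi lie_relator y) = vpi lie_relator (free_br x y).
Proof.
have brDl u v w := GRing.zmod_morphism_linear (free_br_linear_l w) u v.
have brDr u v w := GRing.zmod_morphism_linear (free_br_linear_r w) u v.
have br_l u v : u \in span lie_relator -> free_br u v \in span lie_relator.
  move=> /spanP; elim=> [w rw||k w z _ IHw _ IHz].
  - by apply/spanP; apply: Spanned_gen; exact: Relator_br_l.
  - by rewrite (linear_eq0 (free_br_linear_l v)) rpred0.
  - by rewrite free_br_linear_l rpredD ?rpredZ.
have br_r u v : v \in span lie_relator -> free_br u v \in span lie_relator.
  move=> /spanP; elim=> [w rw||k w z _ IHw _ IHz].
  - by apply/spanP; apply: Spanned_gen; exact: Relator_br_r.
  - by rewrite (linear_eq0 (free_br_linear_r u)) rpred0.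
  - by rewrite free_br_linear_r rpredD ?rpredZ.
apply/vpi_eq; rewrite -(subrK (free_br x (vrepr (vpi lie_relator y))) (free_br _ _)).
rewrite -addrA -brDl -brDr.
by apply: rpredD; [apply: br_l | apply: br_r]; apply/vpi_eq; rewrite vreprK.
Qed.

Fact lie_br_linear_l y : linear (lie_br ^~ y).
Proof.
move=> k x z; rewrite -[x]vreprK -[y]vreprK -[z]vreprK.
by rewrite -linearP !lie_br_pi free_br_linear_l linearP.
Qed.

Fact lie_br_linear_r x : linear (lie_br x).
Proof.
move=> k y z; rewrite -[x]vreprK -[y]vreprK -[z]vreprK.
by rewrite -linearP !lie_br_pi free_br_linear_r linearP.
Qed.

Fact lie_br_part n d n' d' x y : lie_part n d x -> lie_part n' d' y ->
  lie_part (n + n').+1 (d + d') (lie_br x y).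
Proof.
have br0l u : lie_br 0 u = 0 := linear_eq0 (lie_br_linear_l u).
have br0r u : lie_br u 0 = 0 := linear_eq0 (lie_br_linear_r u).
move=> Px Py; elim: Px => {x} [_ [s [sn sd ->]]||k x z _ IHx _ IHz]; last 2 first.
- by rewrite br0l; exact: Spanned0.
- by rewrite lie_br_linear_l; exact: SpannedP.
elim: Py => {y} [_ [t [tn td ->]]||k y z _ IHy _ IHz]; last 2 first.
- by rewrite br0r; exact: Spanned0.
- by rewrite lie_br_linear_r; exact: SpannedP.
apply: Spanned_gen; exists (Br s t).
by rewrite /= sn sd tn td /lie_word lie_br_pi free_br_word.
Qed.

(* The completion A = \bigoplus_d A_d, as the subspace of nat -> L spanned by *)
(* the A_d = \prod_n L^(n)_d; part x n is the n-bracket component of x.       *)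
Definition series_deg (d : int) (f : nat -> lie) : Prop :=
  forall n, lie_part n d (f n).

Definition complete_pred : {pred nat -> lie} :=
  span (fun f => exists d, series_deg d f).

Record complete := Complete {
  part :> nat -> lie;
  part_complete : part \in complete_pred }.

HB.instance Definition _ := [isSub for part].
HB.instance Definition _ := [Choice of complete by <:].
HB.instance Definition _ := GRing.SubmodClosed.on complete_pred.
HB.instance Definition _ := [SubChoice_isSubLmodule of complete by <:].

Definition cdeg (d : int) (x : complete) : Prop := series_deg d x.

(* A bracket of elements of L^(i) and L^(j) involves i + j + 1 brackets.      *)
Definition series_br (f g : nat -> lie) (n : nat) : lie :=
  \sum_(i < n) lie_br (f i) (g (n - i.+1)%N).

Fact series_br_linear_l g : linear (series_br ^~ g).
Proof.
move=> k f h; apply/funext => n; rewrite /series_br [RHS]/GRing.add /=.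
rewrite [X in _ = X + _]scaler_sumr -big_split.
by apply: eq_bigr => i _; exact: lie_br_linear_l.
Qed.

Fact series_br_linear_r f : linear (series_br f).
Proof.
move=> k g h; apply/funext => n; rewrite /series_br [RHS]/GRing.add /=.
rewrite [X in _ = X + _]scaler_sumr -big_split.
by apply: eq_bigr => i _; exact: lie_br_linear_r.
Qed.

Fact series_br_deg d e f g :
  series_deg d f -> series_deg e g -> series_deg (d + e) (series_br f g).
Proof.
move=> df eg n; rewrite /series_br.
apply: big_ind => [|x y Px Py|i _]; first exact: Spanned0.
  by rewrite -[x]scale1r; exact: SpannedP.
have := lie_br_part (df i) (eg (n - i.+1)%N).
by rewrite -addSn subnKC.
Qed.

Fact series_br_complete (x y : complete) : series_br x y \in complete_pred.
Proof.
case: x y => [f /= /spanP Pf] [g /= /spanP Pg].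
elim: Pf => {f} [f [d df]||k f h _ IHf _ IHh]; last 2 first.
- by rewrite (linear_eq0 (series_br_linear_l g)) rpred0.
- by rewrite series_br_linear_l rpredD ?rpredZ.
elim: Pg => {g} [g [e eg]||k g h _ IHg _ IHh]; last 2 first.
- by rewrite (linear_eq0 (series_br_linear_r f)) rpred0.
- by rewrite series_br_linear_r rpredD ?rpredZ.
by apply/spanP/Spanned_gen; exists (d + e); exact: series_br_deg.
Qed.

Definition cbr (x y : complete) : complete := Complete (series_br_complete x y).

Definition word_series (w : word) (n : nat) : lie :=
  if n == word_brackets w then lie_word w else 0.

Fact word_series_complete w : word_series w \in complete_pred.
Proof.
apply/spanP/Spanned_gen; exists (word_deg w) => n; rewrite /word_series.
case: eqP => [->|_]; last exact: Spanned0.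
by apply: Spanned_gen; exists w.
Qed.

Definition cword (w : word) : complete := Complete (word_series_complete w).

Definition ca : complete := cword (Gen Gen_a).
Definition cb : complete := cword (Gen Gen_b).
Definition ce : complete := cword (Gen Gen_e).

Definition beyond (N : nat) (x : complete) : Prop :=
  forall n, (n <= N)%N -> x n = 0.

(* B^(N); beyond N is already a subspace, so the span adds nothing.           *)
Definition trunc (N : nat) : lmodType rat := vquot (beyond N).

Definition tpi (N : nat) (x : complete) : trunc N := vpi (beyond N) x.

(* Well defined, since beyond N is an ideal.                                  *)
Definition tbr (N : nat) (x y : trunc N) : trunc N :=
  tpi N (cbr (vrepr x) (vrepr y)).

(* Elements of V (x) Q[t] are represented by their sequences of coefficients  *)
(* in V, trailing zeros being allowed.                                        *)
Definition vpoly_eval (V : lmodType rat) (u : seq V) (t : rat) : V :=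
  \sum_(k < size u) t ^+ k *: u`_k.

(* du/dt = d v - [v, u] and u(0) = x in B^(N) (x) Q[t], the differential      *)
(* equation being written coefficientwise.                                    *)
Definition flow_solution (d : complete -> complete) (N : nat)
    (v x : complete) (u : seq (trunc N)) : Prop :=
  vpoly_eval u 0 = tpi N x /\ forall k, (k.+1%:R : rat) *: u`_k.+1 =
    (if k == 0%N then tpi N (d v) else 0 : trunc N) - tbr (tpi N v) u`_k.

Definition flow_moves (d : complete -> complete) (v x y : complete) : Prop :=
  forall N, exists u : seq (trunc N),
    flow_solution d v x u /\ vpoly_eval u 1 = tpi N y.

Definition infinite_sum (f : nat -> complete) (s : complete) : Prop :=
  forall N, exists M, forall m, (M <= m)%N ->
    tpi N (\sum_(i < m) f i) = tpi N s.

(* Formal power series over Q, given by their coefficients.                   *)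
Definition ps_mul (f g : nat -> rat) (n : nat) : rat :=
  \sum_(i < n.+1) f i * g (n - i)%N.

(* (sum_n B_n x^n / n!) (e^x - 1) = x                                         *)
Definition bernoulli (B : nat -> rat) : Prop :=
  ps_mul (fun n => B n / n`!%:R)
         (fun n => if n == 0%N then 0 else 1 / n`!%:R)
  =1 (fun n => (n == 1%N)%:R).

(* Main.v *)
From HB Require Import structures.
Require Import Defs.
From mathcomp Require Import all_boot all_order all_algebra.
From mathcomp Require Import ring.
From mathcomp.classical Require Import boolp functions.
From mathcomp.multinomials Require Import freeg.

Set Implicit Arguments.
Unset Strict Implicit.
Unset Printing Implicit Defensive.

Import GRing.Theory Num.Theory.
Local Open Scope ring_scope.

(** Write E = ad_e and d for the differential. Formal power series
    in E act on the completion, because E raises the number of brackets by one;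
    the computations with the flow reduce to identities between such series.

    The flow equation u' = de - E u with u(0) = a has the solution
    u(t) = e^(-tE) a + ((1 - e^(-tE))/E) de, so the flow of e moves a to b in
    unit time exactly when e^(-E) a + ((1 - e^(-E))/E) de = b
    ([flow_moves_e]). The series (1 - e^(-x))/x is invertible, and its product
    with x/(e^x - 1) is e^(-x); hence this condition is equivalent to the stated
    formula for de ([flow_equation]). Flatness prescribes da and db.

    Uniqueness is then the fact that a derivation is determined by its values on
    the generators ([derivation_determined]). Every homogeneous element is, up
    to a combination of generators, a sum of brackets [g, y] with g a generator,
    so the components of the difference of two such derivations vanish one after
    the other.

    For existence, a derivation of the free graded Lie algebra with arbitrary
    homogeneous values on the generators is constructed on words by the Leibniz
    rule ([lie_der]). Applying this to each component of the prescribed values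
    gives derivations raising the number of brackets by 0, 1, 2 and so on, whose
    sum is a derivation of the completion ([cder]). Its square is again a
    derivation, so it remains to show that it kills the generators. On a and b
    this is the identity [x, [x, x]] = 0 ([flat_square]). On e, consider the
    curvature f = du + [u, u]/2 along the flow line from a to b. It satisfies
    f' = d(de) - [e, f], which is the flow equation with d(de) in place of de, so
    f(1) = e^(-E) f(0) + ((1 - e^(-E))/E) d(de). Since a and b are flat,
    f(0) = f(1) = 0, and invertibility of (1 - e^(-x))/x gives d(de) = 0
    ([flat_flow_square], [ps_act_phiN_inj]).

    The completion is a graded Lie algebra because the free graded Lie algebra
    is the direct sum of its homogeneous parts ([lie_direct]), which are
    eigenspaces of the automorphism multiplying a word of degree n by 2^n. *)

(** * Linear algebra over the rationals *)

(** The trivial square-zero extension of the rationals by [V]: a commutative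
    ring that contains [V], so that the tactic [ring] decides identities
    between linear combinations of vectors. *)
Definition sqzero (V : lmodType rat) : Type := (rat * V)%type.

HB.instance Definition _ (V : lmodType rat) := GRing.Zmodule.on (sqzero V).

Definition sqzero_mul (V : lmodType rat) (x y : sqzero V) : sqzero V :=
  (x.1 * y.1, x.1 *: y.2 + y.1 *: x.2).

Fact sqzero_mulA (V : lmodType rat) : associative (@sqzero_mul V).
Proof.
move=> [a x] [b y] [c z]; rewrite /sqzero_mul /= mulrA !scalerDr !scalerA.
by rewrite addrA (mulrC c a) (mulrC c b).
Qed.

Fact sqzero_mulC (V : lmodType rat) : commutative (@sqzero_mul V).
Proof. by move=> [a x] [b y]; rewrite /sqzero_mul /= mulrC addrC. Qed.

Fact sqzero_mul1 (V : lmodType rat) : left_id (1, 0 : V) (@sqzero_mul V).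
Proof.
by move=> [a x]; rewrite /sqzero_mul /= mul1r scale1r scaler0 addr0.
Qed.

Fact sqzero_mulDl (V : lmodType rat) : left_distributive (@sqzero_mul V) +%R.
Proof.
move=> [a x] [b y] [c z]; rewrite /sqzero_mul /=; congr pair => /=.
  by rewrite mulrDl.
by rewrite scalerDl scalerDr addrACA.
Qed.

Fact sqzero_1neq0 (V : lmodType rat) : (1, 0 : V) != 0 :> sqzero V.
Proof. by apply/eqP => -[/eqP]; rewrite oner_eq0. Qed.

HB.instance Definition _ (V : lmodType rat) :=
  GRing.Zmodule_isComNzRing.Build (sqzero V) (@sqzero_mulA V) (@sqzero_mulC V)
    (@sqzero_mul1 V) (@sqzero_mulDl V) (sqzero_1neq0 V).

Definition sqzero_scalar (V : lmodType rat) (k : rat) : sqzero V := (k, 0).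
Definition sqzero_vec (V : lmodType rat) (x : V) : sqzero V := (0, x).

Fact sqzero_scalar_zmod (V : lmodType rat) : zmod_morphism (@sqzero_scalar V).
Proof. by move=> k l; congr pair; rewrite /= subrr. Qed.

Fact sqzero_scalar_monoid (V : lmodType rat) : monoid_morphism (@sqzero_scalar V).
Proof.
by split=> // k l; congr pair; rewrite /= !scaler0 addr0.
Qed.

HB.instance Definition _ (V : lmodType rat) :=
  GRing.isZmodMorphism.Build rat (sqzero V) (@sqzero_scalar V)
    (@sqzero_scalar_zmod V).
HB.instance Definition _ (V : lmodType rat) :=
  GRing.isMonoidMorphism.Build rat (sqzero V) (@sqzero_scalar V)
    (@sqzero_scalar_monoid V).

Fact sqzero_vecD (V : lmodType rat) : {morph @sqzero_vec V : x y / x + y}.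
Proof. by move=> x y; congr pair; rewrite /= addr0. Qed.

Fact sqzero_vecN (V : lmodType rat) : {morph @sqzero_vec V : x / - x}.
Proof. by move=> x; congr pair; rewrite /= oppr0. Qed.

Fact sqzero_vec0 (V : lmodType rat) : sqzero_vec (0 : V) = 0.
Proof. by []. Qed.

Fact sqzero_vecZ (V : lmodType rat) k (x : V) :
  sqzero_vec (k *: x) = sqzero_scalar V k * sqzero_vec x.
Proof.
by congr pair; rewrite /= ?mulr0 // scale0r addr0.
Qed.

Fact sqzero_vec_inj (V : lmodType rat) : injective (@sqzero_vec V).
Proof. by move=> x y []. Qed.

Ltac module_ring :=
  apply: sqzero_vec_inj; rewrite ?(sqzero_vec0, sqzero_vecD, sqzero_vecN, sqzero_vecZ);
  ring.

Section LinearMaps.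
Variables (U V : lmodType rat) (f : U -> V).
Hypothesis f_linear : linear f.

Lemma linear_mapD : {morph f : x y / x + y}.
Proof. by move=> x y; have := f_linear 1 x y; rewrite !scale1r. Qed.

Lemma linear_mapZ k : {morph f : x / k *: x}.
Proof. by move=> x; have := f_linear k x 0; rewrite !addr0 linear_eq0 ?addr0. Qed.

Lemma linear_mapN : {morph f : x / - x}.
Proof. by move=> x; rewrite -scaleN1r linear_mapZ scaleN1r. Qed.

Lemma linear_mapB : {morph f : x y / x - y}.
Proof. by move=> x y; rewrite linear_mapD linear_mapN. Qed.

Lemma linear_map_sum (I : Type) (r : seq I) (P : pred I) (F : I -> U) :
  f (\sum_(i <- r | P i) F i) = \sum_(i <- r | P i) f (F i).
Proof. exact: (big_morph f linear_mapD (linear_eq0 f_linear)). Qed.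

End LinearMaps.

Section Spanned.
Variables (V : lmodType rat) (P : V -> Prop).

Lemma spannedD x y : spanned P x -> spanned P y -> spanned P (x + y).
Proof. by move=> Px Py; rewrite -[x]scale1r; exact: SpannedP. Qed.

Lemma spannedZ k x : spanned P x -> spanned P (k *: x).
Proof. by move=> Px; rewrite -[_ *: _]addr0; apply: SpannedP => //; exact: Spanned0. Qed.

Lemma spannedN x : spanned P x -> spanned P (- x).
Proof. by rewrite -scaleN1r; exact: spannedZ. Qed.

Lemma spanned_sum (I : Type) (r : seq I) (Q : pred I) (F : I -> V) :
  (forall i, Q i -> spanned P (F i)) -> spanned P (\sum_(i <- r | Q i) F i).
Proof.
by move=> PF; apply: big_ind => //; [exact: Spanned0 | exact: spannedD].
Qed.

Lemma spanned_map (W : lmodType rat) (Q : W -> Prop) (f : V -> W) :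
  linear f -> (forall x, P x -> spanned Q (f x)) ->
  forall x, spanned P x -> spanned Q (f x).
Proof.
move=> fL fP x; elim=> {x} [x /fP //||k x y _ IHx _ IHy].
  by rewrite linear_eq0 //; exact: Spanned0.
by rewrite fL; exact: SpannedP.
Qed.

Lemma spanned_eq (W : lmodType rat) (f g : V -> W) :
  linear f -> linear g -> (forall x, P x -> f x = g x) ->
  forall x, spanned P x -> f x = g x.
Proof.
move=> fL gL fg x; elim=> {x} [x /fg //||k x y _ IHx _ IHy].
  by rewrite !linear_eq0.
by rewrite fL gL IHx IHy.
Qed.

End Spanned.

Arguments spanned_map {V P W} Q {f} _ _ {x}.

Lemma linear_comp (U V W : lmodType rat) (f : V -> W) (g : U -> V) :
  linear f -> linear g -> linear (fun x => f (g x)).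
Proof. by move=> fL gL k x y; rewrite gL fL. Qed.

Lemma linear_map0 (U V : lmodType rat) : linear (fun _ : U => 0 : V).
Proof. by move=> k x y; rewrite scaler0 addr0. Qed.

(** * The free graded Lie algebra *)

Definition lie_pi : free_alg -> lie := vpi lie_relator.

Lemma lie_pi_linear : linear lie_pi.
Proof. by move=> k x y; rewrite /lie_pi linearP. Qed.

Lemma lie_pi_relator r : lie_relator r -> lie_pi r = 0.
Proof.
move=> rr; rewrite -(linear_eq0 lie_pi_linear); apply/vpi_eq.
by rewrite subr0; apply/spanP; exact: Spanned_gen.
Qed.

Lemma lie_pi_br x y : lie_pi (free_br x y) = lie_br (lie_pi x) (lie_pi y).
Proof. by rewrite lie_br_pi. Qed.

Lemma lie_word_br s t : lie_word (Br s t) = lie_br (lie_word s) (lie_word t).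
Proof. by rewrite /lie_word lie_br_pi free_br_word. Qed.

Lemma lie_br0l y : lie_br 0 y = 0.
Proof. exact: linear_eq0 (lie_br_linear_l y). Qed.

Lemma lie_br0r x : lie_br x 0 = 0.
Proof. exact: linear_eq0 (lie_br_linear_r x). Qed.

Lemma free_spanned x : spanned (fun x => exists w, x = free_word w) x.
Proof.
rewrite -[x]freeg_sumE; apply: spanned_sum => w _.
have ->: << coeff w x *g w >> = coeff w x *: free_word w.
  by apply/eqP/freeg_eqP => t; rewrite coeffZ !coeffU mul1r.
by apply: spannedZ; apply: Spanned_gen; exists w.
Qed.

Section WordMap.
Variables (M : lmodType rat) (f : word -> M).

Lemma fglift_linear : linear (fglift f : free_alg -> M).
Proof. by move=> k x y; rewrite linearP. Qed.

Lemma fglift_word w : fglift f (free_word w) = f w.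
Proof. by rewrite liftU scale1r. Qed.

End WordMap.

Lemma free_bilinear_eq (M : lmodType rat) (f g : free_alg -> free_alg -> M) :
  (forall y, linear (f ^~ y)) -> (forall x, linear (f x)) ->
  (forall y, linear (g ^~ y)) -> (forall x, linear (g x)) ->
  (forall s t, f (free_word s) (free_word t) = g (free_word s) (free_word t)) ->
  forall x y, f x y = g x y.
Proof.
move=> fl fr gl gr fg x y.
apply: (spanned_eq (fl y) (gl y) _ (free_spanned x)) => _ [s ->].
by apply: (spanned_eq (fr _) (gr _) _ (free_spanned y)) => _ [t ->].
Qed.

Definition lie_lift (M : lmodType rat) (f : free_alg -> M) (x : lie) : M :=
  f (vrepr x).

Section LieLift.
Variables (M : lmodType rat) (f : free_alg -> M).
Hypothesis f_linear : linear f.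
Hypothesis f_relator : forall r, lie_relator r -> f r = 0.

Lemma lie_liftE x : lie_lift f (lie_pi x) = f x.
Proof.
apply/eqP; rewrite -subr_eq0 -(linear_mapB f_linear); apply/eqP.
have /spanP : vrepr (lie_pi x) - x \in Defs.span lie_relator.
  by apply/vpi_eq; rewrite vreprK.
exact: (spanned_eq f_linear (@linear_map0 _ _)).
Qed.

Lemma lie_lift_linear : linear (lie_lift f).
Proof.
move=> k x y; rewrite -[x]vreprK -[y]vreprK -lie_pi_linear.
by rewrite !lie_liftE f_linear.
Qed.

End LieLift.

Definition lie_hom (d : int) (x : lie) : Prop :=
  spanned (fun x => exists2 w, word_deg w = d & x = lie_word w) x.

Lemma lie_part_hom n d x : lie_part n d x -> lie_hom d x.
Proof.
apply: (spanned_map _ (f := id)) => // {}x [w [_ wd ->]].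
by apply: Spanned_gen; exists w.
Qed.

Lemma lie_word_part w : lie_part (word_brackets w) (word_deg w) (lie_word w).
Proof. by apply: Spanned_gen; exists w. Qed.

Lemma lie_hom_lift d x : lie_hom d x -> exists2 x0, free_deg d x0 & x = lie_pi x0.
Proof.
elim=> {x} [_ [w wd ->]||k _ _ _ [x xd ->] _ [y yd ->]].
- by exists (free_word w) => //; apply: Spanned_gen; exists w.
- by exists 0; [exact: Spanned0 | rewrite (linear_eq0 lie_pi_linear)].
- by exists (k *: x + y); [exact: SpannedP | rewrite lie_pi_linear].
Qed.

Lemma free_deg_hom d x : free_deg d x -> lie_hom d (lie_pi x).
Proof.
apply: (spanned_map _ lie_pi_linear) => _ [w wd ->].
by apply: Spanned_gen; exists w.
Qed.

Lemma free_deg_br m n x y :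
  free_deg m x -> free_deg n y -> free_deg (m + n) (free_br x y).
Proof.
move=> xm; apply: (spanned_map _ (free_br_linear_r x)) => _ [t tn ->].
apply: (spanned_map _ (free_br_linear_l _)) xm => _ [s sm ->].
by apply: Spanned_gen; exists (Br s t); rewrite ?free_br_word //= sm tn.
Qed.

Lemma lie_hom_br m n x y :
  lie_hom m x -> lie_hom n y -> lie_hom (m + n) (lie_br x y).
Proof.
move=> /lie_hom_lift[x0 xm ->] /lie_hom_lift[y0 yn ->].
by rewrite -lie_pi_br; apply/free_deg_hom/free_deg_br.
Qed.

Lemma lie_brC m n x y : lie_hom m x -> lie_hom n y ->
  lie_br y x = - (koszul m n *: lie_br x y).
Proof.
move=> /lie_hom_lift[x0 xm ->] /lie_hom_lift[y0 yn ->].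
have := lie_pi_relator (Relator_antisym xm yn).
rewrite (linear_mapD lie_pi_linear) (linear_mapZ lie_pi_linear) !lie_pi_br.
by move/eqP; rewrite addr_eq0 => /eqP.
Qed.

Lemma lie_brA m n p x y z : lie_hom m x -> lie_hom n y -> lie_hom p z ->
  lie_br (lie_br x y) z = lie_br x (lie_br y z) - koszul m n *: lie_br y (lie_br x z).
Proof.
move=> /lie_hom_lift[x0 xm ->] /lie_hom_lift[y0 yn ->] /lie_hom_lift[z0 zp ->].
have := lie_pi_relator (Relator_jacobi xm yn zp).
rewrite !(linear_mapB lie_pi_linear) (linear_mapZ lie_pi_linear) !lie_pi_br.
by move/eqP; rewrite subr_eq0 => /eqP.
Qed.

(** Multiplying every word by the power of [q] given by its degree is an
    endomorphism compatible with all relations. The case [q = -1] provides the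
    sign of the Leibniz rule, and [q = 2] separates the degrees. *)
Definition free_scaling (q : rat) : free_alg -> lie :=
  fglift (fun w => q ^ word_deg w *: lie_word w).

Lemma free_scaling_deg q d x : free_deg d x -> free_scaling q x = q ^ d *: lie_pi x.
Proof.
have L : linear (fun x => q ^ d *: lie_pi x).
  by move=> k y z; rewrite lie_pi_linear; module_ring.
apply: spanned_eq (fglift_linear _) L _ x => _ [w <- ->].
by rewrite /free_scaling fglift_word.
Qed.

Lemma free_scaling_br q x y : q != 0 ->
  free_scaling q (free_br x y) = lie_br (free_scaling q x) (free_scaling q y).
Proof.
move=> q0; have L := fglift_linear (fun w => q ^ word_deg w *: lie_word w).
apply: (free_bilinear_eq (f := fun x y => free_scaling q (free_br x y))
  (g := fun x y => lie_br (free_scaling q x) (free_scaling q y))) x y.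
- by move=> y; exact: linear_comp L (free_br_linear_l y).
- by move=> x; exact: linear_comp L (free_br_linear_r x).
- by move=> y; exact: linear_comp (lie_br_linear_l _) L.
- by move=> x; exact: linear_comp (lie_br_linear_r _) L.
move=> s t; rewrite free_br_word /free_scaling !fglift_word lie_word_br /=.
rewrite (linear_mapZ (lie_br_linear_l _)) (linear_mapZ (lie_br_linear_r _)).
by rewrite scalerA expfzDr.
Qed.

(** The antisymmetry and Jacobi relators are homogeneous, hence multiplied by
    a scalar; the ideal they generate follows by multiplicativity. *)
Lemma free_scaling_relator q r : q != 0 -> lie_relator r -> free_scaling q r = 0.
Proof.
move=> q0 rr.
have homog d x : free_deg d x -> lie_relator x -> free_scaling q x = 0.
  by move=> /free_scaling_deg-> /lie_pi_relator->; rewrite scaler0.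
elim: rr => [m n x y xm yn|m n p x y z xm yn zp|x y _ IH|x y _ IH].
- apply: (homog (m + n)); last exact: Relator_antisym.
  apply: spannedD; first by rewrite addrC; exact: free_deg_br.
  by apply: spannedZ; exact: free_deg_br.
- apply: (homog (m + n + p)); last exact: (@Relator_jacobi m n p).
  apply: spannedD; first by do 2?[apply: free_deg_br].
  apply/spannedN/spannedD; first by rewrite -addrA; do 2?[apply: free_deg_br].
  apply/spannedN/spannedZ; rewrite addrAC addrC.
  by do 2?[apply: free_deg_br].
- by rewrite free_scaling_br // IH lie_br0l.
- by rewrite free_scaling_br // IH lie_br0r.
Qed.

Definition lie_scaling (q : rat) : lie -> lie := lie_lift (free_scaling q).

Lemma lie_scaling_linear q : q != 0 -> linear (lie_scaling q).
Proof.
move=> q0; apply: lie_lift_linear => [|r]; first exact: fglift_linear.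
exact: free_scaling_relator.
Qed.

Lemma lie_scaling_hom q d x : q != 0 -> lie_hom d x -> lie_scaling q x = q ^ d *: x.
Proof.
move=> q0 /lie_hom_lift[x0 xd ->]; rewrite /lie_scaling lie_liftE.
- exact: free_scaling_deg.
- exact: fglift_linear.
- by move=> r; exact: free_scaling_relator.
Qed.

(** Homogeneous elements of distinct degrees are eigenvectors of the scaling
    by 2 for distinct eigenvalues, hence linearly independent. *)
Lemma lie_direct (s : seq int) (c : int -> lie) : uniq s ->
  (forall n, n \in s -> lie_hom n (c n)) -> \sum_(n <- s) c n = 0 ->
  forall n, n \in s -> c n = 0.
Proof.
have two0 : 2 != 0 :> rat by [].
elim: s c => [//|p s IH] c /= /andP[ps us] ch.
rewrite big_cons => sum0.
have cs n : n \in s -> c n = 0.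
  move=> ns; have np : n != p by apply: contraNneq ps => <-.
  (* Subtracting 2 ^ p times the relation from its image under the scaling *)
  (* eliminates c p. *)
  have : (2 ^ n - 2 ^ p : rat) *: c n = 0.
    apply: (IH (fun n => (2 ^ n - 2 ^ p) *: c n)) ns => // [k ks|].
      by apply/spannedZ/ch; rewrite inE ks orbT.
    have : lie_scaling 2 (c p + \sum_(n <- s) c n)
        - 2 ^ p *: (c p + \sum_(n <- s) c n) = 0.
      by rewrite sum0 scaler0 subr0 linear_eq0 //; exact: lie_scaling_linear.
    have L := lie_scaling_linear two0.
    rewrite (linear_mapD L) (lie_scaling_hom two0 (ch p _)) ?mem_head //.
    rewrite (linear_map_sum L) scalerDr opprD addrACA subrr add0r scaler_sumr -sumrB.
    apply: etrans; apply: eq_big_seq => k ks.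
    by rewrite (lie_scaling_hom two0 (ch k _)) ?inE ?ks ?orbT // scalerBl.
  move/eqP; rewrite scaler_eq0 subr_eq0 => /orP[|/eqP //].
  by rewrite (inj_eq (@ieexprIz _ 2 _ _)) // (negPf np).
move=> n; rewrite inE => /orP[/eqP->|/cs //].
by move: sum0; rewrite big_seq big1 ?addr0.
Qed.

(** * Derivations of the free graded Lie algebra *)

Definition degsgn (m : int) : rat := (-1) ^ m.

Lemma degsgnM_self m : degsgn m * degsgn m = 1.
Proof. by rewrite /degsgn -expfzMl // mulrN1 opprK exp1rz. Qed.

Lemma degsgnD m n : degsgn (m + n) = degsgn m * degsgn n.
Proof. by rewrite /degsgn expfzDr. Qed.

Lemma degsgnN m : degsgn (- m) = degsgn m.
Proof. by rewrite /degsgn -exprz_inv invrN1. Qed.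

Lemma degsgn_pred m : degsgn (m - 1) = - degsgn m.
Proof. by rewrite degsgnD degsgnN /degsgn expr1z mulrN1. Qed.

Lemma degsgnP m : degsgn m = 1 \/ degsgn m = -1.
Proof.
have /eqP := degsgnM_self m; rewrite -expr2 sqrf_eq1.
by case/orP => /eqP; [left | right].
Qed.

Lemma koszul_predr m n : koszul m (n - 1) = koszul m n * degsgn m.
Proof. by rewrite /koszul mulrBr mulr1 -!/(degsgn _) degsgnD degsgnN. Qed.

Lemma koszul_predl m n : koszul (m - 1) n = koszul m n * degsgn n.
Proof. by rewrite /koszul mulrBl mul1r -!/(degsgn _) degsgnD degsgnN. Qed.

(** The values of a derivation at the generators can be prescribed freely: the
    Leibniz rule determines it on words, and is compatible with the relations. *)
Section LieDerivation.
Variable v : gen -> lie.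
Hypothesis v_hom : forall g, lie_hom (gen_deg g - 1) (v g).

Fixpoint word_der (w : word) : lie :=
  match w with
  | Gen g => v g
  | Br s t => lie_br (word_der s) (lie_word t)
      + degsgn (word_deg s) *: lie_br (lie_word s) (word_der t)
  end.

Definition free_der : free_alg -> lie := fglift word_der.

Lemma free_der_linear : linear free_der.
Proof. exact: fglift_linear. Qed.

(** Writing the sign of the Leibniz rule as the scaling by -1 makes the rule
    bilinear, so that it also covers the inhomogeneous elements occurring in
    the ideal of relations. *)
Lemma free_der_br_scaling x y : free_der (free_br x y) =
  lie_br (free_der x) (lie_pi y) + lie_br (free_scaling (-1) x) (free_der y).
Proof.
have L := free_der_linear; have P := lie_pi_linear.
have S : linear (free_scaling (-1)) := fglift_linear _.
have add_lin (f g : free_alg -> lie) :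
    linear f -> linear g -> linear (fun x => f x + g x).
  by move=> fL gL k z t; rewrite fL gL; module_ring.
apply: (free_bilinear_eq (f := fun x y => free_der (free_br x y))
  (g := fun x y => lie_br (free_der x) (lie_pi y)
                   + lie_br (free_scaling (-1) x) (free_der y))) x y.
- by move=> y; exact: linear_comp L (free_br_linear_l y).
- by move=> x; exact: linear_comp L (free_br_linear_r x).
- move=> y; apply: add_lin; first exact: linear_comp (lie_br_linear_l _) L.
  exact: linear_comp (lie_br_linear_l _) S.
- move=> x; apply: add_lin; first exact: linear_comp (lie_br_linear_r _) P.
  exact: linear_comp (lie_br_linear_r _) L.
move=> s t; rewrite free_br_word /free_der /free_scaling !fglift_word /=.
by rewrite (linear_mapZ (lie_br_linear_l _)).
Qed.

Lemma free_der_br m x y : free_deg m x -> free_der (free_br x y) =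
  lie_br (free_der x) (lie_pi y) + degsgn m *: lie_br (lie_pi x) (free_der y).
Proof.
move=> xm; rewrite free_der_br_scaling (free_scaling_deg _ xm).
by rewrite (linear_mapZ (lie_br_linear_l _)).
Qed.

Lemma free_der_hom m x : free_deg m x -> lie_hom (m - 1) (free_der x).
Proof.
apply: (spanned_map _ free_der_linear) => _ [w <- ->].
rewrite /free_der fglift_word; elim: w => [g|s IHs t IHt] /=; first exact: v_hom.
apply: spannedD; first by rewrite addrAC; apply/lie_hom_br/lie_part_hom/lie_word_part.
by rewrite -addrA; apply/spannedZ/lie_hom_br => //; apply/lie_part_hom/lie_word_part.
Qed.

(** On a generating relator, the Leibniz rule gives one term for each
    argument; these cancel by the same relation in the quotient, applied with
    that argument replaced by its image, whose degree is shifted by -1. *)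
Lemma free_der_relator r : lie_relator r -> free_der r = 0.
Proof.
have L := free_der_linear.
elim=> [m n x y xm yn|m n p x y z xm yn zp|x y rx IH|x y ry IH].
- rewrite (linear_mapD L) (linear_mapZ L) (free_der_br _ xm) (free_der_br _ yn).
  have [xh yh] := (free_deg_hom xm, free_deg_hom yn).
  rewrite (lie_brC xh (free_der_hom yn)) (lie_brC (free_der_hom xm) yh).
  rewrite koszul_predl koszul_predr.
  by case: (degsgnP m) => ->; case: (degsgnP n) => ->; module_ring.
- rewrite !(linear_mapB L) (linear_mapZ L).
  have xy := free_deg_br xm yn.
  rewrite (free_der_br _ xy) !(free_der_br _ xm) !(free_der_br _ yn).
  rewrite !(free_der_br _ xm) !lie_pi_br.
  rewrite !(linear_mapD (lie_br_linear_l _)) !(linear_mapD (lie_br_linear_r _)).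
  rewrite !(linear_mapZ (lie_br_linear_l _)) !(linear_mapZ (lie_br_linear_r _)).
  have [[xh yh] zh] := (free_deg_hom xm, free_deg_hom yn, free_deg_hom zp).
  rewrite (lie_brA (free_der_hom xm) yh zh) (lie_brA xh (free_der_hom yn) zh).
  rewrite (lie_brA xh yh (free_der_hom zp)) koszul_predl koszul_predr degsgnD.
  by case: (degsgnP m) => ->; case: (degsgnP n) => ->; module_ring.
- rewrite free_der_br_scaling IH (free_scaling_relator _ rx) //.
  by rewrite !lie_br0l addr0.
- by rewrite free_der_br_scaling IH (lie_pi_relator ry) !lie_br0r addr0.
Qed.

Definition lie_der : lie -> lie := lie_lift free_der.

Lemma lie_der_pi x : lie_der (lie_pi x) = free_der x.
Proof. exact: (lie_liftE free_der_linear free_der_relator). Qed.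

Lemma lie_der_linear : linear lie_der.
Proof. exact: (lie_lift_linear free_der_linear free_der_relator). Qed.

Lemma lie_der_gen g : lie_der (lie_word (Gen g)) = v g.
Proof. by rewrite lie_der_pi /free_der fglift_word. Qed.

Lemma lie_der_br m x y : lie_hom m x ->
  lie_der (lie_br x y) = lie_br (lie_der x) y + degsgn m *: lie_br x (lie_der y).
Proof.
move=> /lie_hom_lift[x0 xm ->]; rewrite -[y]vreprK -lie_pi_br !lie_der_pi.
exact: free_der_br.
Qed.

Lemma lie_der_part j : (forall g, lie_part j (gen_deg g - 1) (v g)) ->
  forall n d x, lie_part n d x -> lie_part (n + j) (d - 1) (lie_der x).
Proof.
move=> v_part n d x; apply: (spanned_map _ lie_der_linear) => _ [w [<- <- ->]].
elim: w => [g|s IHs t IHt] /=; first by rewrite lie_der_gen; exact: v_part.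
rewrite lie_word_br (lie_der_br _ (lie_part_hom (lie_word_part s))) addSn.
apply: spannedD.
  by rewrite addrAC addnAC; exact: lie_br_part IHs (lie_word_part t).
by rewrite -addrA -addnA; exact/spannedZ/(lie_br_part (lie_word_part s) IHt).
Qed.

End LieDerivation.

(** * The completed free graded Lie algebra *)

(** Associativity of the Cauchy product, for a general trilinear term. With
    the exchange of indices below, it lifts the Jacobi identity and the Leibniz
    rule from the components to the series. *)
Lemma sum_triangleA (V : nmodType) (F : nat -> nat -> nat -> V) n :
  \sum_(i < n.+1) \sum_(j < (n - i).+1) F i j (n - i - j)%N =
  \sum_(k < n.+1) \sum_(i < k.+1) F i (k - i)%N (n - k)%N.
Proof.
transitivity (\sum_(i < n.+1) \sum_(k < n.+1 | (i <= k)%N) F i (k - i)%N (n - k)%N).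
  apply: eq_bigr => i _; have le_in : (i <= n)%N by rewrite -ltnS.
  rewrite -(big_mkord xpredT (fun j => F i j (n - i - j)%N)).
  rewrite -(big_mkord (fun k => true && (i <= k))%N (fun k => F i (k - i)%N (n - k)%N)).
  rewrite -(big_nat_widenl _ _ _ xpredT) //.
  rewrite -[X in _ = \sum_(X <= _ < _) _]add0n big_addn subSn //.
  by apply: eq_bigr => j _; rewrite addnK addnC subnDA.
rewrite (exchange_big_dep xpredT) //=; apply: eq_bigr => k _.
rewrite (big_ord_widen n.+1 (fun i => F i (k - i)%N (n - k)%N) (ltn_ord k)).
by apply: eq_bigl => i; rewrite ltnS.
Qed.

Lemma sum_triangleC (V : nmodType) (F : nat -> nat -> V) n :
  \sum_(i < n.+1) \sum_(j < (n - i).+1) F i j =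
  \sum_(j < n.+1) \sum_(i < (n - j).+1) F i j.
Proof.
have widen (G : nat -> V) (i : 'I_n.+1) :
    \sum_(j < (n - i).+1) G j = \sum_(j < n.+1 | (j < (n - i).+1)%N) G j.
  by rewrite (big_ord_widen n.+1) // ltnS leq_subr.
under eq_bigr => i _ do rewrite widen.
rewrite (exchange_big_dep xpredT) //=; apply: eq_bigr => j _.
rewrite (widen (F ^~ j)); apply: eq_bigl => i.
by rewrite !ltnS !leq_subRL 1?addnC // -ltnS.
Qed.

Lemma complete_ext (x y : complete) : (forall n, x n = y n) -> x = y.
Proof. by move=> xy; apply/val_inj/funext. Qed.

Lemma cpartD (x y : complete) n : (x + y) n = x n + y n. Proof. by []. Qed.
Lemma cpartN (x : complete) n : (- x) n = - x n. Proof. by []. Qed.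
Lemma cpartZ k (x : complete) n : (k *: x) n = k *: x n. Proof. by []. Qed.
Lemma cpart0 n : (0 : complete) n = 0. Proof. by []. Qed.
Definition cpartE := (cpart0, cpartD, cpartN, cpartZ).

Lemma cpart_sum (I : Type) (r : seq I) (P : pred I) (F : I -> complete) n :
  (\sum_(i <- r | P i) F i) n = \sum_(i <- r | P i) F i n.
Proof.
exact: (big_morph (fun x : complete => x n) (fun x y => cpartD x y n) (cpart0 n)).
Qed.

(* Simplification would otherwise unfold the components of a bracket. *)
#[local] Arguments part : simpl never.

Lemma cbr0 x y : cbr x y 0 = 0.
Proof. exact: big_ord0. Qed.

Lemma cbrS x y n : cbr x y n.+1 = \sum_(i < n.+1) lie_br (x i) (y (n - i)%N).
Proof. by []. Qed.

Lemma cbr_linear_l y : linear (cbr ^~ y).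
Proof. by move=> k x z; apply: val_inj; exact: series_br_linear_l. Qed.

Lemma cbr_linear_r x : linear (cbr x).
Proof. by move=> k y z; apply: val_inj; exact: series_br_linear_r. Qed.

Lemma cdeg0 d : cdeg d 0.
Proof. by move=> n; exact: Spanned0. Qed.

Lemma cdegP d k x y : cdeg d x -> cdeg d y -> cdeg d (k *: x + y).
Proof. by move=> xd yd n; apply: SpannedP; [exact: xd | exact: yd]. Qed.

Lemma cdegD d x y : cdeg d x -> cdeg d y -> cdeg d (x + y).
Proof. by move=> xd yd n; apply: spannedD; [exact: xd | exact: yd]. Qed.

Lemma cdegZ d k x : cdeg d x -> cdeg d (k *: x).
Proof. by move=> xd n; apply: spannedZ; exact: xd. Qed.

Lemma cdeg_br m n x y : cdeg m x -> cdeg n y -> cdeg (m + n) (cbr x y).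
Proof. exact: series_br_deg. Qed.

Lemma cdeg_hom d x n : cdeg d x -> lie_hom d (x n).
Proof. by move=> xd; apply: lie_part_hom; exact: xd. Qed.

Lemma complete_spanned x : spanned (fun y => exists d, cdeg d y) x.
Proof.
have main f : spanned (fun f => exists d, series_deg d f) f ->
    forall fP, spanned (fun y => exists d, cdeg d y) (@Complete f fP).
  elim=> {f} [f [d fd] fP||k f g fS IHf gS IHg fgP].
  - by apply: Spanned_gen; exists d.
  - by move=> fP; have -> : Complete fP = 0 by [apply: val_inj]; exact: Spanned0.
  - have [fP gP] : f \in complete_pred /\ g \in complete_pred by split; apply/spanP.
    have -> : Complete fgP = k *: Complete fP + Complete gP by apply: val_inj.
    by apply: SpannedP; [exact: IHf | exact: IHg].
by case: x => f fP; apply: main; apply/spanP.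
Qed.

(** The components of a series are graded by [lie_direct], and a series of the
    completion involves finitely many degrees by definition. *)
Lemma complete_grading : is_grading cdeg.
Proof.
split=> [d|d k x y|x|s c us cd sum0 n ns]; [exact: cdeg0 | exact: cdegP | |].
- (* Summing over any larger list lets two decompositions be added without *)
  (* merging their lists of degrees. *)
  have [s [c [cd sumE]]] : exists (s : seq int) (c : int -> complete),
      (forall n, cdeg n (c n)) /\
      (forall s', uniq s' -> {subset s <= s'} -> x = \sum_(n <- s') c n).
    elim: (complete_spanned x) =>
      {x} [x [d xd]||k x y _ [s [c [cd cE]]] _ [t [b [bd bE]]]].
    + exists [:: d], (fun n => if n == d then x else 0); split=> [n|s' us' ds'].
        by case: eqP => [->//|_]; exact: cdeg0.
      rewrite (bigD1_seq d) ?ds' ?mem_head //= eqxx big1 ?addr0 //.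
      by move=> n /negPf ->.
    + by exists [::], (fun=> 0); split=> [n|s' _ _]; [exact: cdeg0 | rewrite big1].
    + exists (s ++ t), (fun n => k *: c n + b n); split=> [n|s' us' sub].
        exact: cdegP.
      rewrite big_split -scaler_sumr /= -cE -?bE // => n ns; apply: sub.
        by rewrite mem_cat ns orbT.
      by rewrite mem_cat ns.
  exists (undup s), c; split=> //; apply: sumE; first exact: undup_uniq.
  by move=> n; rewrite mem_undup.
- apply: complete_ext => i; apply: (lie_direct (c := fun n => c n i) us) ns.
    by move=> k _; exact: cdeg_hom.
  by rewrite -cpart_sum sum0.
Qed.

Lemma cbrC m n x y : cdeg m x -> cdeg n y -> cbr y x = - (koszul m n *: cbr x y).
Proof.
move=> xm yn; apply: complete_ext => -[|k]; rewrite !cpartE ?cbr0 ?scaler0 ?oppr0 //.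
rewrite !cbrS scaler_sumr -sumrN (reindex_inj rev_ord_inj) /=.
apply: eq_bigr => i _; rewrite subSS subKn -1?ltnS //.
by apply: lie_brC; exact: cdeg_hom.
Qed.

(** A double bracket has no component with fewer than two brackets; the
    component with [k.+2] brackets is a sum over [i + j + l = k], on which the
    Jacobi identity holds term by term. *)
Lemma cbrA m n p x y z : cdeg m x -> cdeg n y -> cdeg p z ->
  cbr (cbr x y) z = cbr x (cbr y z) - koszul m n *: cbr y (cbr x z).
Proof.
have cbr1 u v w : cbr u (cbr v w) 1 = 0 by rewrite cbrS big_ord1 cbr0 lie_br0r.
have cbrrE u v w k : cbr u (cbr v w) k.+2 = \sum_(i < k.+1)
    \sum_(j < (k - i).+1) lie_br (u i) (lie_br (v j) (w (k - i - j)%N)).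
  rewrite cbrS big_ord_recr /= subnn cbr0 lie_br0r addr0; apply: eq_bigr => i _.
  by rewrite subSn -1?ltnS // cbrS (linear_map_sum (lie_br_linear_r _)).
move=> xm yn zp; apply: complete_ext => -[|[|k]]; rewrite !cpartE.
- by rewrite !cbr0 scaler0 subr0.
- by rewrite !cbr1 cbrS big_ord1 cbr0 lie_br0l scaler0 subr0.
rewrite !cbrrE cbrS big_ord_recl cbr0 lie_br0l add0r.
transitivity (\sum_(i < k.+1) \sum_(j < (k - i).+1)
    lie_br (lie_br (x i) (y j)) (z (k - i - j)%N)).
  rewrite (sum_triangleA (fun i j l => lie_br (lie_br (x i) (y j)) (z l))).
  by apply: eq_bigr => i _; rewrite cbrS subSS (linear_map_sum (lie_br_linear_l _)).
rewrite (sum_triangleC (fun i j => lie_br (y i) (lie_br (x j) (z (k - i - j)%N)))).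
rewrite scaler_sumr -sumrB; apply: eq_bigr => i _.
rewrite scaler_sumr -sumrB; apply: eq_bigr => j _; rewrite subnAC.
by apply: (lie_brA (p := p)); exact: cdeg_hom.
Qed.

Lemma complete_graded_lie : is_graded_lie cdeg cbr.
Proof.
split; [exact: complete_grading | exact: cbr_linear_l | exact: cbr_linear_r | ..].
- exact: cdeg_br.
- exact: cbrC.
- exact: cbrA.
Qed.

(** * Operators raising the number of brackets *)

(** Operators [T i] on the free Lie algebra raising the number of brackets by
    exactly [i]: only finitely many of them contribute to each component, so
    their sum acts on the completion. Both the derivations and the power series
    in the adjoint action of [e] arise in this way. *)
Record shift_family (q : int) := ShiftFamily {
  shift_op :> nat -> lie -> lie;
  shift_linear : forall i, linear (shift_op i);
  shift_part : forall i n d x,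
    lie_part n d x -> lie_part (n + i) (d + q) (shift_op i x) }.

Definition series_op q (T : shift_family q) (f : nat -> lie) (n : nat) : lie :=
  \sum_(i < n.+1) T i (f (n - i)%N).

Lemma series_op_linear q (T : shift_family q) : linear (series_op T).
Proof.
move=> k f g; apply/funext => n; rewrite /series_op [RHS]/GRing.add /=.
rewrite [X in _ = X + _]scaler_sumr -big_split.
by apply: eq_bigr => i _; exact: shift_linear.
Qed.

Lemma series_op_deg q (T : shift_family q) d f :
  series_deg d f -> series_deg (d + q) (series_op T f).
Proof.
move=> fd n; apply: spanned_sum => i _.
by have := shift_part T i (fd (n - i)%N); rewrite subnK // -ltnS.
Qed.

Fact series_op_complete q (T : shift_family q) (x : complete) :
  series_op T x \in complete_pred.
Proof.
apply/spanP; have /spanP := part_complete x.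
apply: (spanned_map _ (@series_op_linear _ T)) => g [d gd].
by apply: Spanned_gen; exists (d + q); exact: series_op_deg.
Qed.

Definition cseries_op q (T : shift_family q) (x : complete) : complete :=
  Complete (series_op_complete T x).

Section CSeriesOp.
Variables (q : int) (T : shift_family q).

Lemma cseries_opE x n : cseries_op T x n = \sum_(i < n.+1) T i (x (n - i)%N).
Proof. by []. Qed.

Lemma cseries_op_linear : linear (cseries_op T).
Proof. by move=> k x y; apply: val_inj; exact: series_op_linear. Qed.

Lemma cseries_op_deg d x : cdeg d x -> cdeg (d + q) (cseries_op T x).
Proof. exact: series_op_deg. Qed.

End CSeriesOp.

(** * Derivations of the completion *)

Definition cgen (g : gen) : complete := cword (Gen g).

Lemma cgen_deg g : cdeg (gen_deg g) (cgen g).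
Proof.
case=> [|n]; first exact: lie_word_part (Gen g).
exact: Spanned0.
Qed.

Lemma cgen_partS g n : cgen g n.+1 = 0. Proof. by []. Qed.

Lemma cbr_genS g x n : cbr (cgen g) x n.+1 = lie_br (lie_word (Gen g)) (x n).
Proof.
rewrite cbrS big_ord_recl subn0 big1 ?addr0 // => i _.
by rewrite cgen_partS lie_br0l.
Qed.

Section ExtendDerivation.
Variable v : gen -> complete.
Hypothesis v_deg : forall g, cdeg (gen_deg g - 1) (v g).

Let v_hom n g : lie_hom (gen_deg g - 1) (v g n).
Proof. exact: cdeg_hom. Qed.

(** The component of [v] with [j] brackets defines a derivation that raises the
    number of brackets by [j]; the derivation with values [v] is their sum. *)
Definition der_family : shift_family (-1) :=
  ShiftFamily (fun i => lie_der_linear (v_hom i))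
    (fun i => lie_der_part (v_hom i) (fun g => v_deg g i)).

Definition cder : complete -> complete := cseries_op der_family.

Lemma cder_gen g : cder (cgen g) = v g.
Proof.
apply: complete_ext => n; rewrite cseries_opE big_ord_recr subnn /= lie_der_gen //.
rewrite big1 ?add0r // => i _.
by rewrite -(subnSK (ltn_ord i)) cgen_partS (linear_eq0 (lie_der_linear _)).
Qed.

Lemma cder_leibniz m x y : cdeg m x ->
  cder (cbr x y) = cbr (cder x) y + degsgn m *: cbr x (cder y).
Proof.
move=> xm; apply: complete_ext => -[|n]; rewrite !cpartE cseries_opE.
  by rewrite big_ord1 !cbr0 scaler0 addr0 (linear_eq0 (shift_linear _ _)).
rewrite big_ord_recr subnn cbr0 /=.
rewrite (linear_eq0 (lie_der_linear (v_hom _))) addr0.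
transitivity (\sum_(i < n.+1) \sum_(j < (n - i).+1)
   (lie_br (der_family i (x j)) (y (n - i - j)%N)
    + degsgn m *: lie_br (x j) (der_family i (y (n - i - j)%N)))).
  apply: eq_bigr => i _; rewrite subSn -1?ltnS // cbrS.
  rewrite (linear_map_sum (lie_der_linear (v_hom i))); apply: eq_bigr => j _.
  by apply: (lie_der_br (v_hom i)); exact: cdeg_hom.
under eq_bigr => i _ do rewrite big_split; rewrite big_split; congr (_ + _).
  rewrite (sum_triangleA (fun i j l => lie_br (der_family i (x j)) (y l))) cbrS.
  by apply: eq_bigr => k _; rewrite cseries_opE (linear_map_sum (lie_br_linear_l _)).
rewrite (sum_triangleC (fun i j =>
  degsgn m *: lie_br (x j) (der_family i (y (n - i - j)%N)))).
rewrite cbrS scaler_sumr; apply: eq_bigr => j _.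
rewrite cseries_opE (linear_map_sum (lie_br_linear_r _)) scaler_sumr.
by apply: eq_bigr => i _; rewrite subnAC.
Qed.

Lemma cder_derivation : is_derivation cdeg cbr cder.
Proof.
split; first exact: cseries_op_linear.
  by move=> n x; exact: cseries_op_deg.
by move=> m n x y xm _; exact: cder_leibniz.
Qed.

End ExtendDerivation.

(** * Derivations are determined by their values on the generators *)

Definition gens : seq gen := [:: Gen_a; Gen_b; Gen_e].

Definition gen_expansion n d (x : lie) : Prop :=
  exists y : gen -> lie, (forall g, lie_part n (d - gen_deg g) (y g)) /\
    x = \sum_(g <- gens) lie_br (lie_word (Gen g)) (y g).

Lemma gen_expansion0 n d : gen_expansion n d 0.
Proof.
exists (fun=> 0); split=> [g|]; first exact: Spanned0.
by rewrite big1 // => g _; rewrite lie_br0r.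
Qed.

Lemma gen_expansionP n d k x y :
  gen_expansion n d x -> gen_expansion n d y -> gen_expansion n d (k *: x + y).
Proof.
move=> [u [up ->]] [v [vp ->]]; exists (fun g => k *: u g + v g); split=> [g|].
  by apply: SpannedP; [exact: up | exact: vp].
rewrite scaler_sumr -big_split; apply: eq_bigr => g _.
by rewrite lie_br_linear_r.
Qed.

(** The reason why right-nested brackets of generators span: by the Jacobi
    identity, a bracket of [s, t] with y is a combination of [s, [t, y]] and
    [t, [s, y]], whose left arguments are shorter words. *)
Lemma gen_expansion_br s n d y : lie_part n d y ->
  gen_expansion (n + word_brackets s) (d + word_deg s) (lie_br (lie_word s) y).
Proof.
elim: s n d y => [g|s IHs t IHt] n d y yp.
  rewrite addn0 /=; case: g.
  - exists (fun h => if h is Gen_a then y else 0); split.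
      by case; rewrite ?addrK //; exact: Spanned0.
    by rewrite !big_cons big_nil !lie_br0r !addr0.
  - exists (fun h => if h is Gen_b then y else 0); split.
      by case; rewrite ?addrK //; exact: Spanned0.
    by rewrite !big_cons big_nil !lie_br0r !addr0 add0r.
  - exists (fun h => if h is Gen_e then y else 0); split.
      by case; rewrite ?addrK //; exact: Spanned0.
    by rewrite !big_cons big_nil !lie_br0r !addr0 !add0r.
have [sp tp] := (lie_word_part s, lie_word_part t).
rewrite lie_word_br (lie_brA (lie_part_hom sp) (lie_part_hom tp) (lie_part_hom yp)).
rewrite -scaleNr [X in gen_expansion _ _ X]addrC; apply: gen_expansionP => /=.
  have := IHt _ _ _ (lie_br_part sp yp).
  by congr (gen_expansion _ _ _); ring.
have := IHs _ _ _ (lie_br_part tp yp).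
by congr (gen_expansion _ _ _); ring.
Qed.

Lemma lie_part_expansion n d x : lie_part n.+1 d x -> gen_expansion n d x.
Proof.
elim=> {x} [_ [[g|s t] [//= wn <- ->]]||k x y _ IHx _ IHy].
- rewrite lie_word_br addrC; case: wn => <-; rewrite addnC.
  exact: gen_expansion_br (lie_word_part t).
- exact: gen_expansion0.
- exact: gen_expansionP.
Qed.

Lemma lie_part0_expansion d x : lie_part 0 d x ->
  exists k : gen -> rat, x = \sum_(g <- gens) k g *: lie_word (Gen g).
Proof.
elim=> {x} [_ [[g|s t] [// _ _ ->]]||k x y _ [u ->] _ [v ->]].
- case: g.
  + exists (fun h => if h is Gen_a then 1 else 0).
    by rewrite !big_cons big_nil !scale0r scale1r !addr0.
  + exists (fun h => if h is Gen_b then 1 else 0).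
    by rewrite !big_cons big_nil !scale0r scale1r !addr0 add0r.
  + exists (fun h => if h is Gen_e then 1 else 0).
    by rewrite !big_cons big_nil !scale0r scale1r !addr0 !add0r.
- by exists (fun=> 0); rewrite big1 // => g _; rewrite scale0r.
- exists (fun g => k * u g + v g); rewrite scaler_sumr -big_split.
  by apply: eq_bigr => g _; rewrite scalerDl scalerA.
Qed.

Lemma complete_expansion d x : cdeg d x ->
  exists (k : gen -> rat) (y : gen -> complete), (forall g, cdeg (d - gen_deg g) (y g)) /\
    x = \sum_(g <- gens) (k g *: cgen g + cbr (cgen g) (y g)).
Proof.
move=> xd; have [k x0E] := lie_part0_expansion (xd 0%N).
have [y yP] := choice (fun n => lie_part_expansion (xd n.+1)).
have y_complete g : (y ^~ g) \in complete_pred.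
  by apply/spanP/Spanned_gen; exists (d - gen_deg g) => n; have [/(_ g)] := yP n.
exists k, (fun g => Complete (y_complete g)); split=> [g n|].
  by have [/(_ g)] := yP n.
apply: complete_ext => n; rewrite cpart_sum.
case: n => [|n].
  by rewrite x0E; apply: eq_bigr => g _; rewrite !cpartE cbr0 addr0.
rewrite (proj2 (yP n)); apply: eq_bigr => g _.
by rewrite !cpartE cbr_genS cgen_partS scaler0 add0r.
Qed.

(** Every homogeneous x is, up to generators, a sum of brackets [g, y], and
    f [g, y] is a multiple of [g, f y]. So if no value of f has a component with
    fewer than N brackets, then no value has one with N brackets either. *)
Lemma gen_determined (f : complete -> complete) : linear f ->
  (forall g, f (cgen g) = 0) ->
  (forall g d y, cdeg d y -> exists k, f (cbr (cgen g) y) = k *: cbr (cgen g) (f y)) ->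
  forall x, f x = 0.
Proof.
move=> fL f_gen f_br.
have main N d x : cdeg d x -> forall n, (n < N)%N -> f x n = 0.
  elim: N d x => // N IH d x /complete_expansion[k [y [yd ->]]] n nN.
  rewrite (linear_map_sum fL) cpart_sum big1 // => g _.
  rewrite fL f_gen scaler0 add0r; have [c ->] := f_br g _ _ (yd g).
  rewrite cpartZ; case: n nN => [|n] nN; first by rewrite cbr0 scaler0.
  by rewrite cbr_genS (IH _ _ (yd g)) // lie_br0r scaler0.
move=> x; apply: (spanned_eq fL (@linear_map0 _ _) _ (complete_spanned x)) => y [d yd].
by apply: complete_ext => n; apply: (main n.+1 d).
Qed.

Lemma derivation_determined (d d' : complete -> complete) :
  is_derivation cdeg cbr d -> is_derivation cdeg cbr d' ->
  (forall g, d' (cgen g) = d (cgen g)) -> d' = d.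
Proof.
move=> dD d'D eq_gen; have [dL d'L] := (der_linear dD, der_linear d'D).
apply/funext => x; apply/eqP; rewrite -subr_eq0; apply/eqP.
apply: (gen_determined (f := fun x => d' x - d x)) => [k y z|g|g p y yp].
- by rewrite dL d'L; module_ring.
- by rewrite eq_gen subrr.
- exists (degsgn (gen_deg g)).
  rewrite (der_leibniz dD (cgen_deg g) yp) (der_leibniz d'D (cgen_deg g) yp).
  rewrite eq_gen (linear_mapB (cbr_linear_r _)) -!/(degsgn _); module_ring.
Qed.

(** The square of an odd derivation is a derivation, because the two mixed
    terms carry opposite signs. *)
Lemma derivation_square (d : complete -> complete) : is_derivation cdeg cbr d ->
  (forall g, d (d (cgen g)) = 0) -> forall x, d (d x) = 0.
Proof.
move=> dD dd_gen; have dL := der_linear dD.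
apply: gen_determined => [k y z|//|g p y yp]; first by rewrite !dL.
exists 1; have gd := cgen_deg g.
rewrite (der_leibniz dD gd yp) (linear_mapD dL) (linear_mapZ dL).
rewrite (der_leibniz dD (der_deg dD gd) yp) (der_leibniz dD gd (der_deg dD yp)).
rewrite dd_gen (linear_eq0 (cbr_linear_l _)) -!/(degsgn _) degsgn_pred.
by case: (degsgnP (gen_deg g)) => ->; module_ring.
Qed.

(** * Power series in the adjoint action of e *)

Lemma tpi_eq N x y : tpi N x = tpi N y <-> forall n, (n <= N)%N -> x n = y n.
Proof.
split=> [/vpi_eq/spanP xy|xy].
  have {}xy : beyond N (x - y).
    elim: xy => {x y} [x //|//|k x y _ bx _ byy] n nN.
    by rewrite !cpartE bx // byy // scaler0 addr0.
  by move=> n /xy; rewrite !cpartE => /eqP; rewrite subr_eq0 => /eqP.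
apply/vpi_eq/spanP/Spanned_gen => n nN.
by rewrite !cpartE xy // subrr.
Qed.

Lemma complete_tpi_ext x y : (forall N, tpi N x = tpi N y) -> x = y.
Proof. by move=> xy; apply: complete_ext => n; have /tpi_eq := xy n; exact. Qed.

Lemma tpi_linear N : linear (tpi N).
Proof. by move=> k x y; rewrite /tpi linearP. Qed.

Lemma tpi_vrepr N x : tpi N (vrepr (tpi N x)) = tpi N x.
Proof. exact: vreprK. Qed.

Lemma cbr_local N (x y x' y' : complete) :
  (forall n, (n < N)%N -> x n = x' n) -> (forall n, (n < N)%N -> y n = y' n) ->
  cbr x y N = cbr x' y' N.
Proof.
case: N => [|n] xx yy; first by rewrite !cbr0.
rewrite !cbrS; apply: eq_bigr => i _; rewrite xx // yy //.
by rewrite ltnS leq_subr.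
Qed.

(** The bracket descends to the truncations, since each component of a bracket
    involves only lower components of its arguments. *)
Lemma tbr_tpi N x y : tbr (tpi N x) (tpi N y) = tpi N (cbr x y).
Proof.
apply/tpi_eq => n nN; apply: cbr_local => m mn.
  by have /tpi_eq := tpi_vrepr N x; apply; exact: leq_trans (ltnW mn) nN.
by have /tpi_eq := tpi_vrepr N y; apply; exact: leq_trans (ltnW mn) nN.
Qed.

Lemma cseries_op_local q (T : shift_family q) N (x y : complete) :
  (forall n, (n <= N)%N -> x n = y n) -> cseries_op T x N = cseries_op T y N.
Proof.
by move=> xy; rewrite !cseries_opE; apply: eq_bigr => i _; rewrite xy // leq_subr.
Qed.

Notation ad_e := (cbr ce).

Lemma ad_eS x n : ad_e x n.+1 = lie_br (lie_word (Gen Gen_e)) (x n).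
Proof. exact: (cbr_genS Gen_e). Qed.

Lemma iter_linear (V : lmodType rat) (f : V -> V) i : linear f -> linear (iter i f).
Proof. by move=> fL; elim: i => // i IH k x y; rewrite !iterS IH fL. Qed.

Lemma iter_ad_e_part i x n : iter i ad_e x n =
  if (i <= n)%N then iter i (lie_br (lie_word (Gen Gen_e))) (x (n - i)%N) else 0.
Proof.
elim: i n => [|i IH] n; first by rewrite subn0.
rewrite iterS; case: n => [|n]; first exact: cbr0.
by rewrite ad_eS IH ltnS subSS; case: leqP => // _; rewrite lie_br0r.
Qed.

Lemma iter_ad_e_deg i d x : cdeg d x -> cdeg d (iter i ad_e x).
Proof.
move=> xd; elim: i => //= i IH.
by rewrite -[d]add0r; apply: cdeg_br IH; exact: (cgen_deg Gen_e).
Qed.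

Fact ad_family_linear (f : nat -> rat) i :
  linear (fun x => f i *: iter i (lie_br (lie_word (Gen Gen_e))) x).
Proof.
move=> k x y; rewrite (iter_linear i (lie_br_linear_r _)); module_ring.
Qed.

Fact ad_family_part (f : nat -> rat) i n d x : lie_part n d x ->
  lie_part (n + i) (d + 0) (f i *: iter i (lie_br (lie_word (Gen Gen_e))) x).
Proof.
move=> xp; rewrite addr0; apply: spannedZ; elim: i => [|i IH]; first by rewrite addn0.
have := lie_br_part (lie_word_part (Gen Gen_e)) IH.
by rewrite /= add0r add0n addnS.
Qed.

(** The value of a formal power series at the topologically nilpotent operator
    [ad_e]; it turns identities between power series into identities between
    operators. *)
Definition ps_act (f : nat -> rat) : complete -> complete :=
  cseries_op (ShiftFamily (ad_family_linear f) (@ad_family_part f)).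

Lemma ps_act_linear f : linear (ps_act f).
Proof. exact: cseries_op_linear. Qed.

(** As [ad_e] raises the number of brackets by one, the powers beyond the
    [n]-th do not reach the component with [n] brackets. *)
Lemma ps_act_partial (f : nat -> rat) x n M : (n < M)%N ->
  (\sum_(i < M) f i *: iter i ad_e x) n = ps_act f x n.
Proof.
move=> nM; rewrite cpart_sum cseries_opE.
rewrite (big_ord_widen M (fun i => f i *:
  iter i (lie_br (lie_word (Gen Gen_e))) (x (n - i)%N)) nM).
rewrite [RHS]big_mkcond; apply: eq_bigr => i _.
by rewrite cpartZ iter_ad_e_part ltnS; case: leqP => // _; rewrite scaler0.
Qed.

Lemma ps_act_sum (f : nat -> rat) x :
  infinite_sum (fun i => f i *: iter i ad_e x) (ps_act f x).
Proof.
move=> N; exists N.+1 => M NM; apply/tpi_eq => n nN.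
by apply: ps_act_partial; exact: leq_ltn_trans nN NM.
Qed.

Lemma ps_act_eq f g x : f =1 g -> ps_act f x = ps_act g x.
Proof.
move=> fg; apply: complete_ext => n; rewrite !cseries_opE.
by apply: eq_bigr => i _ /=; rewrite fg.
Qed.

Lemma ps_act_sub (f g : nat -> rat) x :
  ps_act (fun n => f n - g n) x = ps_act f x - ps_act g x.
Proof.
apply: complete_ext => n; rewrite !cpartE !cseries_opE -sumrB.
by apply: eq_bigr => i _ /=; rewrite scalerBl.
Qed.

Lemma ps_act_mul f g x : ps_act f (ps_act g x) = ps_act (ps_mul f g) x.
Proof.
have L := iter_linear _ (lie_br_linear_r (lie_word (Gen Gen_e))).
apply: complete_ext => n; rewrite !cseries_opE /=.
transitivity (\sum_(i < n.+1) \sum_(j < (n - i).+1) (f i * g j) *: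
    iter (i + j) (lie_br (lie_word (Gen Gen_e))) (x (n - i - j)%N)).
  apply: eq_bigr => i _; rewrite cseries_opE (linear_map_sum (L i)) scaler_sumr.
  by apply: eq_bigr => j _; rewrite /= (linear_mapZ (L i)) scalerA iterD.
rewrite (sum_triangleA (fun i j l => (f i * g j) *:
  iter (i + j) (lie_br (lie_word (Gen Gen_e))) (x l))).
apply: eq_bigr => k _; rewrite scaler_suml; apply: eq_bigr => i _.
by rewrite subnKC // -ltnS.
Qed.

Definition ps_one (n : nat) : rat := (n == 0%N)%:R.
Definition ps_X (n : nat) : rat := (n == 1%N)%:R.

Lemma ps_act_one x : ps_act ps_one x = x.
Proof.
apply: complete_ext => n; rewrite cseries_opE big_ord_recl /= subn0 scale1r.
by rewrite big1 ?addr0 // => i _; rewrite /ps_one /= scale0r.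
Qed.

Lemma ps_act_X x : ps_act ps_X x = ad_e x.
Proof.
apply: complete_ext => -[|n]; rewrite cseries_opE.
  by rewrite big_ord1 /= scale0r cbr0.
rewrite !big_ord_recl /= scale0r add0r scale1r subSS subn0 ad_eS.
by rewrite big1 ?addr0 // => i _; rewrite /ps_X /= scale0r.
Qed.

(** * The exponential and Bernoulli series *)

Lemma ps_mulA f g h : ps_mul f (ps_mul g h) =1 ps_mul (ps_mul f g) h.
Proof.
move=> n; rewrite /ps_mul.
under eq_bigr => i _ do rewrite mulr_sumr.
rewrite (sum_triangleA (fun i j l => f i * (g j * h l))).
apply: eq_bigr => k _; rewrite mulr_suml; apply: eq_bigr => i _.
by rewrite mulrA.
Qed.

Lemma ps_mulC f g : ps_mul f g =1 ps_mul g f.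
Proof.
move=> n; rewrite /ps_mul (reindex_inj rev_ord_inj); apply: eq_bigr => i _ /=.
by rewrite subSS subKn -1?ltnS // mulrC.
Qed.

Lemma ps_mul_eq f f' g g' : f =1 f' -> g =1 g' -> ps_mul f g =1 ps_mul f' g'.
Proof. by move=> ff gg n; apply: eq_bigr => i _; rewrite ff gg. Qed.

Lemma ps_mul1 f : ps_mul f ps_one =1 f.
Proof.
move=> n; rewrite /ps_mul big_ord_recr /= subnn mulr1 big1 ?add0r // => i _.
by rewrite /ps_one subn_eq0 leqNgt ltn_ord mulr0.
Qed.

Lemma ps_mul_shift (f g : nat -> rat) n : g 0%N = 0 ->
  ps_mul f g n.+1 = ps_mul f (fun m => g m.+1) n.
Proof.
move=> g0; rewrite /ps_mul big_ord_recr /= subnn g0 mulr0 addr0.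
by apply: eq_bigr => i _; rewrite subSn // -ltnS.
Qed.

(** The power series e^(-x), (e^x - 1)/x and (1 - e^(-x))/x. *)
Definition ps_expN (n : nat) : rat := (-1) ^+ n / n`!%:R.
Definition ps_phi (n : nat) : rat := 1 / n.+1`!%:R.
Definition ps_phiN (n : nat) : rat := (-1) ^+ n / n.+1`!%:R.

Lemma fact_unit n : n`!%:R != 0 :> rat.
Proof. by rewrite pnatr_eq0 -lt0n fact_gt0. Qed.

(** The binomial expansion of (1 - 1)^n, divided by n!. *)
Lemma ps_expN_exp n : ps_mul ps_expN (fun n => 1 / n`!%:R) n = ps_one n.
Proof.
apply: (mulfI (fact_unit n)); rewrite /ps_mul mulr_sumr.
transitivity ((1 - 1 : rat) ^+ n); last first.
  by rewrite subrr expr0n /ps_one; case: n => [|n]; rewrite ?mulr1 ?mulr0.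
rewrite exprDn; apply: eq_bigr => i _; have le_in : (i <= n)%N by rewrite -ltnS.
rewrite expr1n mul1r -mulr_natr -(bin_fact le_in) !natrM /ps_expN.
by field; rewrite !fact_unit.
Qed.

(** The coefficient of x^(n + 1) in e^(-x) (e^x - 1) = 1 - e^(-x). *)
Lemma ps_expN_phi : ps_mul ps_expN ps_phi =1 ps_phiN.
Proof.
move=> n; pose expB1 m : rat := if m == 0%N then 0 else 1 / m`!%:R.
have /(_ n) <- : forall n, ps_mul ps_expN expB1 n.+1 = ps_mul ps_expN ps_phi n.
  by move=> m; rewrite ps_mul_shift.
have -> : ps_mul ps_expN expB1 n.+1 = ps_one n.+1 - ps_expN n.+1.
  rewrite -ps_expN_exp -(ps_mul1 ps_expN n.+1) /ps_mul -sumrB.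
  apply: eq_bigr => i _; rewrite -mulrBr /expB1 /ps_one.
  by case: (n.+1 - i)%N => [|m]; rewrite ?fact0 ?divr1 ?subrr ?subr0.
by rewrite /ps_one /ps_phiN /ps_expN exprS mulN1r mulNr sub0r opprK.
Qed.

Lemma ps_phiN_X n : ps_mul ps_phiN ps_X n = ps_one n - ps_expN n.
Proof.
case: n => [|n]; first by rewrite /ps_mul big_ord1 mulr0 /ps_expN divr1 subrr.
rewrite ps_mul_shift // (ps_mul_eq (f' := ps_phiN) (g' := ps_one)) // ps_mul1.
by rewrite /ps_one /ps_phiN /ps_expN exprS mulN1r mulNr sub0r opprK.
Qed.

Section Bernoulli.
Variable B : nat -> rat.
Hypothesis B_bernoulli : bernoulli B.

Definition ps_bernoulli (n : nat) : rat := B n / n`!%:R.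

(** The relation defining the Bernoulli numbers, divided by x. *)
Lemma ps_bernoulli_phi : ps_mul ps_bernoulli ps_phi =1 ps_one.
Proof. by move=> n; rewrite -[RHS](B_bernoulli n.+1) ps_mul_shift. Qed.

(** The series (1 - e^(-x))/x is e^(-x) times (e^x - 1)/x, and the second factor
    is inverse to the Bernoulli series. *)
Lemma ps_phiN_bernoulli : ps_mul ps_phiN ps_bernoulli =1 ps_expN.
Proof.
move=> n; rewrite -(ps_mul_eq ps_expN_phi (fun=> erefl)) -ps_mulA.
rewrite (ps_mul_eq (fun=> erefl) (ps_mulC _ _)).
by rewrite (ps_mul_eq (fun=> erefl) ps_bernoulli_phi) ps_mul1.
Qed.

(** By the previous identity, e^x times the Bernoulli series is an inverse of
    (1 - e^(-x))/x. *)
Lemma ps_act_phiN_inj : injective (ps_act ps_phiN).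
Proof.
move=> x y /(congr1 (ps_act ps_bernoulli)); rewrite !ps_act_mul.
have cancel_exp z : ps_act (fun n => 1 / n`!%:R)
    (ps_act (ps_mul ps_bernoulli ps_phiN) z) = z.
  rewrite ps_act_mul -[RHS]ps_act_one; apply: ps_act_eq => n.
  rewrite ps_mulC -ps_expN_exp; apply: ps_mul_eq => // m.
  by rewrite ps_mulC ps_phiN_bernoulli.
by move=> /(congr1 (ps_act (fun n => 1 / n`!%:R))); rewrite !cancel_exp.
Qed.

(** The right-hand side solves the equation because (1 - e^(-x))/x multiplied
    by x is 1 - e^(-x), and multiplied by the Bernoulli series is e^(-x). *)
Lemma flow_equation x y w :
  ps_act ps_expN x + ps_act ps_phiN w = y <->
  w = ad_e y + ps_act ps_bernoulli (y - x).
Proof.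
have solves : ps_act ps_expN x +
    ps_act ps_phiN (ad_e y + ps_act ps_bernoulli (y - x)) = y.
  rewrite (linear_mapD (ps_act_linear _)) -ps_act_X !ps_act_mul.
  rewrite (ps_act_eq _ ps_phiN_X) (ps_act_eq _ ps_phiN_bernoulli).
  rewrite ps_act_sub ps_act_one (linear_mapB (ps_act_linear _)); module_ring.
split=> [e|-> //]; apply: ps_act_phiN_inj.
by apply: (addrI (ps_act ps_expN x)); rewrite solves.
Qed.

End Bernoulli.

(** * The flow generated by e *)

Lemma factV_rec m : m.+1%:R / m.+1`!%:R = m`!%:R^-1 :> rat.
Proof. by rewrite factS natrM invfM mulrA divff ?mul1r // pnatr_eq0. Qed.

Lemma ps_expN_rec m : m.+1%:R * ps_expN m.+1 = - ps_expN m.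
Proof. by rewrite /ps_expN mulrCA factV_rec exprS mulN1r mulNr. Qed.

Lemma ps_phiN_rec m : m.+2%:R * ps_phiN m.+1 = - ps_phiN m.
Proof. by rewrite /ps_phiN mulrCA factV_rec exprS mulN1r mulNr. Qed.

Section FlowCoefficients.
Variables (V : lmodType rat) (E : V -> V).
Hypothesis E_linear : linear E.

(** The Taylor coefficients of u(t) = e^(-tE) x + ((1 - e^(-tE))/E) w, the
    solution of u' = w - E u with u(0) = x. *)
Definition flow_coef (x w : V) (k : nat) : V :=
  if k is j.+1 then ps_expN k *: iter k E x + ps_phiN j *: iter j E w else x.

Lemma flow_coef_rec x w k : k.+1%:R *: flow_coef x w k.+1 =
  (if k == 0%N then w else 0) - E (flow_coef x w k).
Proof.
rewrite /= scalerDr !scalerA ps_expN_rec; case: k => [|k] /=.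
  by rewrite (_ : ps_expN 0 = 1) // (_ : ps_phiN 0 = 1) //; module_ring.
rewrite ps_phiN_rec (linear_mapD E_linear) !(linear_mapZ E_linear); module_ring.
Qed.

Lemma flow_coef_unique w (u : nat -> V) :
  (forall k, k.+1%:R *: u k.+1 = (if k == 0%N then w else 0) - E (u k)) ->
  u =1 flow_coef (u 0%N) w.
Proof.
move=> rec; elim=> // k IH.
have k0 : (k.+1%:R : rat) != 0 by rewrite pnatr_eq0.
by apply: (scalerI k0); rewrite rec flow_coef_rec IH.
Qed.

Lemma sum_flow_coef x w M : \sum_(k < M.+1) flow_coef x w k =
  \sum_(k < M.+1) ps_expN k *: iter k E x + \sum_(k < M) ps_phiN k *: iter k E w.
Proof.
rewrite !big_ord_recl /= /ps_expN divr1 scale1r -addrA; congr (_ + _).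
by rewrite -big_split.
Qed.

End FlowCoefficients.

(** In each truncation the solution is therefore a polynomial in t. *)
Lemma flow_coef_low x w k n : (n.+1 < k)%N -> flow_coef ad_e x w k n = 0.
Proof.
case: k => [|k] nk; first by exfalso; rewrite ltn0 in nk.
rewrite /flow_coef cpartD !cpartZ !iter_ad_e_part.
by rewrite !ifN ?scaler0 ?addr0 // -ltnNge // ltnW.
Qed.

Lemma flow_coef_sum x w n M : (n < M)%N ->
  (\sum_(k < M.+1) flow_coef ad_e x w k) n = (ps_act ps_expN x + ps_act ps_phiN w) n.
Proof.
move=> nM; rewrite sum_flow_coef !cpartD.
by rewrite !ps_act_partial // leqW.
Qed.

Lemma tbr_linear N x : linear (tbr (tpi N x)).
Proof.
move=> k y z; rewrite -[y]vreprK -[z]vreprK -!/(tpi _ _) -tpi_linear !tbr_tpi.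
by rewrite cbr_linear_r tpi_linear.
Qed.

Lemma iter_tbr N i x : iter i (tbr (tpi N ce)) (tpi N x) = tpi N (iter i ad_e x).
Proof. by elim: i => // i IH; rewrite !iterS IH tbr_tpi. Qed.

Lemma flow_solutionP d N x (u : seq (trunc N)) : flow_solution d ce x u ->
  forall k, u`_k = tpi N (flow_coef ad_e x (d ce) k).
Proof.
case=> u0 rec; have {}u0 : u`_0 = tpi N x.
  rewrite -u0 /vpoly_eval; case: u {u0 rec} => [|y u]; first by rewrite big_ord0.
  rewrite big_ord_recl /= scale1r big1 ?addr0 // => i _.
  by rewrite expr0n /= scale0r.
case=> [|k]; first exact: u0.
rewrite (flow_coef_unique (tbr_linear ce) rec) u0 /flow_coef !iter_tbr.
by rewrite (linear_mapD (@tpi_linear N)) !(linear_mapZ (@tpi_linear N)).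
Qed.

(** Setting t = 1 in the solution of the flow equation; in a truncation the
    solution is unique, since its Taylor coefficients satisfy a recursion. *)
Lemma flow_moves_e d x y :
  flow_moves d ce x y <-> ps_act ps_expN x + ps_act ps_phiN (d ce) = y.
Proof.
have eval1 N (u : seq (trunc N)) M :
    (size u <= M)%N -> vpoly_eval u 1 = \sum_(k < M) u`_k.
  move=> uM; rewrite /vpoly_eval (big_ord_widen M (fun k => 1 ^+ k *: u`_k)) //.
  rewrite big_mkcond; apply: eq_bigr => i _; rewrite expr1n scale1r.
  by case: ltnP => // ui; rewrite nth_default.
split=> [flow|<- N].
  apply: complete_tpi_ext => N; have [u [uS <-]] := flow N.
  pose M := maxn (size u) N.+1; have NM : (N < M)%N by rewrite leq_max leqnn orbT.
  rewrite (eval1 _ _ M.+1) ?leqW ?leq_maxl //.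
  rewrite (eq_bigr _ (fun (k : 'I__) _ => flow_solutionP uS k)).
  rewrite -(linear_map_sum (@tpi_linear N)); apply/tpi_eq => n nN.
  by rewrite flow_coef_sum // (leq_ltn_trans nN).
pose u := mkseq (fun k => tpi N (flow_coef ad_e x (d ce) k)) N.+2.
have uE k : u`_k = tpi N (flow_coef ad_e x (d ce) k).
  have [kN|kN] := ltnP k N.+2; first by rewrite nth_mkseq.
  rewrite nth_default ?size_mkseq // -(linear_eq0 (@tpi_linear N)).
  apply/tpi_eq => n nN; rewrite flow_coef_low //.
  exact: leq_trans kN.
exists u; split; last first.
  rewrite (eval1 _ _ N.+2) ?size_mkseq //.
  rewrite (eq_bigr _ (fun (k : 'I__) _ => uE k)) -(linear_map_sum (@tpi_linear N)).
  by apply/tpi_eq => n nN; rewrite flow_coef_sum.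
split=> [|k].
  rewrite /vpoly_eval size_mkseq big_ord_recl uE expr0 scale1r big1 ?addr0 // => i _.
  by rewrite expr0n /= scale0r.
rewrite !uE tbr_tpi -(linear_mapZ (@tpi_linear N)).
rewrite (flow_coef_rec (cbr_linear_r ce)).
rewrite (linear_mapB (@tpi_linear N)); case: k => [//|k] /=.
by rewrite (linear_eq0 (@tpi_linear N)).
Qed.

(** * The flow preserves flatness *)

Lemma cbr_sym x y : cdeg (-1) x -> cdeg (-1) y -> cbr y x = cbr x y.
Proof.
move=> x1 y1.
by rewrite (cbrC x1 y1) /koszul mulN1r opprK expr1z scaleN1r opprK.
Qed.

Lemma ce_deg : cdeg 0 ce.
Proof. exact: (cgen_deg Gen_e). Qed.

Lemma ad_e_br d x y : cdeg d x -> cdeg d y ->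
  ad_e (cbr x y) = cbr (ad_e x) y + cbr x (ad_e y).
Proof.
move=> xd yd; rewrite (cbrA ce_deg xd yd) /koszul mul0r expr0z scale1r.
by rewrite subrK.
Qed.

(** For a power series u(t) of odd elements, the two identities
    ad_e [u, u] = 2 [ad_e u, u] and d/dt [u, u] = 2 [u', u], which follow from
    the symmetry of the bracket on odd elements, in terms of the coefficients of
    u and of its self-bracket [u, u]. *)
Section SelfBracket.
Variable u : nat -> complete.
Hypothesis u_deg : forall k, cdeg (-1) (u k).

Definition self_br (k : nat) : complete := \sum_(i < k.+1) cbr (u i) (u (k - i)%N).

Let u_sym i j : cbr (u i) (u j) = cbr (u j) (u i).
Proof. exact: cbr_sym. Qed.

Lemma ad_e_self_br k : ad_e (self_br k) =
  2 *: \sum_(i < k.+1) cbr (ad_e (u i)) (u (k - i)%N).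
Proof.
rewrite (linear_map_sum (cbr_linear_r _)).
rewrite (eq_bigr _ (fun (i : 'I__) _ => ad_e_br (u_deg i) (u_deg _))).
rewrite big_split scaler_nat mulr2n; congr (_ + _).
rewrite (reindex_inj rev_ord_inj); apply: eq_bigr => i _ /=.
rewrite subSS subKn -1?ltnS // cbr_sym //.
by have := iter_ad_e_deg 1 (u_deg i).
Qed.

Lemma self_br_succ k :
  k.+1%:R *: self_br k.+1 = 2 *: \sum_(i < k.+1) cbr (i.+1%:R *: u i.+1) (u (k - i)%N).
Proof.
pose S := \sum_(i < k.+2) (i%:R : rat) *: cbr (u i) (u (k.+1 - i)%N).
have SE : S = \sum_(i < k.+1) cbr (i.+1%:R *: u i.+1) (u (k - i)%N).
  rewrite /S big_ord_recl scale0r add0r; apply: eq_bigr => i _.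
  by rewrite (linear_mapZ (cbr_linear_l _)) /= subSS.
rewrite -SE [RHS]scaler_nat mulr2n {2}/S (reindex_inj rev_ord_inj) -big_split scaler_sumr.
apply: eq_bigr => i _ /=; have ik : (i <= k.+1)%N by rewrite -ltnS.
rewrite subSS subKn // [cbr (u _) (u i)]u_sym -scalerDl -natrD subnKC //.
Qed.

End SelfBracket.

Section Curvature.
Variable d : complete -> complete.
Hypothesis d_der : is_derivation cdeg cbr d.
Variable x : complete.
Hypothesis x_deg : cdeg (-1) x.

Let u := flow_coef ad_e x (d ce).

Let dL : linear d := der_linear d_der.

Let de_deg : cdeg (-1) (d ce).
Proof. exact: (der_deg d_der ce_deg). Qed.

Let u_deg k : cdeg (-1) (u k).
Proof.
case: k => [|k]; first exact: x_deg.
by apply: cdegD; apply: cdegZ; exact: iter_ad_e_deg.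
Qed.

(** The Taylor coefficients of the curvature f = du + [u, u]/2 of the flow line
    u issued from [x]. *)
Definition flow_curvature (k : nat) : complete := d (u k) + (1 / 2) *: self_br u k.

(** The curvature satisfies f' = d(de) - [e, f], which is the flow equation with
    d(de) in place of de: the terms [de, u] arising from d[e, u] and from
    [u', u] cancel. *)
Lemma flow_curvature_rec k : k.+1%:R *: flow_curvature k.+1 =
  (if k == 0%N then d (d ce) else 0) - ad_e (flow_curvature k).
Proof.
have u_rec j : j.+1%:R *: u j.+1 = (if j == 0%N then d ce else 0) - ad_e (u j).
  exact: flow_coef_rec (cbr_linear_r ce) _ _ _.
have d_ad y : cdeg (-1) y -> d (ad_e y) = cbr (d ce) y + ad_e (d y).
  by move=> yd; rewrite (der_leibniz d_der ce_deg yd) expr0z scale1r.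
have duE : k.+1%:R *: d (u k.+1) =
    (if k == 0%N then d (d ce) else 0) - cbr (d ce) (u k) - ad_e (d (u k)).
  rewrite -(linear_mapZ dL) u_rec (linear_mapB dL) (d_ad _ (u_deg k)) opprD addrA.
  by case: (k) => //= j; rewrite (linear_eq0 dL).
have brE : k.+1%:R *: self_br u k.+1 = 2 *: cbr (d ce) (u k) - ad_e (self_br u k).
  rewrite self_br_succ // ad_e_self_br // -scalerBr; congr (_ *: _).
  rewrite (eq_bigr _ (fun (i : 'I__) _ => congr1 (cbr^~ _) (u_rec i))).
  rewrite (eq_bigr _ (fun (i : 'I__) _ => linear_mapB (cbr_linear_l _) _ _)) sumrB.
  congr (_ - _); rewrite big_ord_recl /= subn0 big1 ?addr0 // => i _.
  exact: linear_eq0 (cbr_linear_l _).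
have halfE : k.+1%:R *: ((1 / 2) *: self_br u k.+1) =
    (1 / 2) *: (2 *: cbr (d ce) (u k) - ad_e (self_br u k)).
  by rewrite -brE !scalerA [X in X *: _]mulrC.
rewrite /flow_curvature scalerDr duE halfE.
rewrite (linear_mapD (cbr_linear_r _)) (linear_mapZ (cbr_linear_r _)).
by rewrite scalerBr scalerA divfK // scale1r; module_ring.
Qed.

Hypothesis d_local : forall (n : nat) (y z : complete),
  (forall m, (m <= n)%N -> y m = z m) -> d y n = d z n.
Variable y : complete.
Hypothesis flow_xy : ps_act ps_expN x + ps_act ps_phiN (d ce) = y.

(** The value at t = 1 of [u, u] is [y, y] if that of u is [y]. The Cauchy
    product and the product of the partial sums agree in the component with [n]
    brackets, since the bracket of [u i] and [u j] has no such component when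
    [i + j > n + 1]. *)
Lemma sum_self_br n M : (n < M)%N ->
  (\sum_(k < M.+1) self_br u k) n = cbr y y n.
Proof.
move=> nM; pose U := \sum_(k < M.+1) u k.
have UE m : (m <= n)%N -> U m = y m.
  by move=> mn; rewrite -flow_xy flow_coef_sum // (leq_ltn_trans mn).
have -> : cbr y y n = cbr U U n.
  by apply: cbr_local => m mn; rewrite UE // ltnW.
rewrite /self_br -(sum_triangleA (fun i j _ => cbr (u i) (u j))).
rewrite (linear_map_sum (cbr_linear_l _)) !cpart_sum; apply: eq_bigr => i _.
rewrite (linear_map_sum (cbr_linear_r _)) !cpart_sum.
rewrite (big_ord_widen M.+1 (fun j => cbr (u i) (u j) n)) ?ltnS ?leq_subr //.
rewrite big_mkcond; apply: eq_bigr => j _; case: ltnP => // ij.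
case: n nM {UE} => [|n] nM; first by rewrite cbr0.
rewrite cbrS big1 // => p _.
have [pi|ip] := ltnP p.+1 i; first by rewrite flow_coef_low ?lie_br0l.
rewrite [u j _]flow_coef_low ?lie_br0r //; have pn : (p <= n)%N by rewrite -ltnS.
rewrite -subSn //; apply: leq_trans ij; rewrite -(@subSn i M); last by rewrite -ltnS.
apply: leq_trans (leq_sub2l _ ip); rewrite subSS ltn_sub2r //.
by apply: leq_ltn_trans (ltnW nM).
Qed.

(** The curvature vanishes at both ends of a flow line joining two flat
    elements. Being itself a flow line for d(de), it takes at t = 1 the value
    ((1 - e^(-ad_e))/ad_e) d(de). *)
Lemma flat_flow_square : flat cbr d x -> flat cbr d y -> ps_act ps_phiN (d (d ce)) = 0.
Proof.
move=> flat_x flat_y.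
have curv0 : flow_curvature 0 = 0.
  by rewrite /flow_curvature /self_br big_ord1 flat_x.
have curvE := flow_coef_unique (cbr_linear_r ce) flow_curvature_rec.
apply: complete_ext => n; pose M := n.+1.
have sum0 : (\sum_(k < M.+1) flow_curvature k) n = 0.
  rewrite /flow_curvature big_split cpartD -scaler_sumr cpartZ sum_self_br //.
  rewrite -(linear_map_sum dL) (d_local (z := y)).
    by rewrite -cpartZ -cpartD flat_y.
  by move=> m mn; rewrite flow_coef_sum ?flow_xy.
rewrite cpart0 -sum0 (eq_bigr _ (fun (k : 'I__) _ => curvE k)) flow_coef_sum //.
by rewrite curv0 (linear_eq0 (ps_act_linear _)) add0r.
Qed.

End Curvature.

(** * The differential *)

Definition diff_gen (B : nat -> rat) (g : gen) : complete :=
  match g with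
  | Gen_a => - (1 / 2%:R : rat) *: cbr ca ca
  | Gen_b => - (1 / 2%:R : rat) *: cbr cb cb
  | Gen_e => cbr ce cb + ps_act (ps_bernoulli B) (cb - ca)
  end.

Lemma ca_deg : cdeg (-1) ca. Proof. exact: (cgen_deg Gen_a). Qed.
Lemma cb_deg : cdeg (-1) cb. Proof. exact: (cgen_deg Gen_b). Qed.

Lemma diff_gen_deg B g : cdeg (gen_deg g - 1) (diff_gen B g).
Proof.
case: g => /=.
- exact: cdegZ (cdeg_br ca_deg ca_deg).
- exact: cdegZ (cdeg_br cb_deg cb_deg).
- apply: cdegD; first exact: cdeg_br ce_deg cb_deg.
  have := cseries_op_deg (ShiftFamily (ad_family_linear (ps_bernoulli B))
    (@ad_family_part (ps_bernoulli B))) (cdegD cb_deg (cdegZ (-1) ca_deg)).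
  by rewrite scaleN1r addr0.
Qed.

Lemma flatE (d : complete -> complete) x :
  flat cbr d x <-> d x = - (1 / 2%:R : rat) *: cbr x x.
Proof.
rewrite /flat scaleNr.
by split=> [/eqP|->]; rewrite ?addNr // addr_eq0 => /eqP.
Qed.

(** If x is flat then d(dx) is a combination of [x, [x, x]] and [[x, x], x],
    which vanish by antisymmetry and the Jacobi identity. *)
Lemma flat_square (d : complete -> complete) x :
  is_derivation cdeg cbr d -> cdeg (-1) x -> flat cbr d x -> d (d x) = 0.
Proof.
move=> dD xd /flatE dx; have dL := der_linear dD.
have xx := cdeg_br xd xd.
have xxx : cbr (cbr x x) x = - cbr x (cbr x x).
  by rewrite (cbrC xd xx) (_ : koszul _ _ = 1) // scale1r.
have jac := cbrA xd xd xd.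
have xxx0 : cbr x (cbr x x) = 0.
  move: jac; rewrite xxx (_ : koszul _ _ = -1) // scaleN1r opprK => jac.
  have : 3 *: cbr x (cbr x x) = 0.
    transitivity (cbr x (cbr x x) + cbr x (cbr x x) - - cbr x (cbr x x)).
      by module_ring.
    by rewrite jac subrr.
  by move/eqP; rewrite scaler_eq0 => /orP[|/eqP].
rewrite {1}dx (linear_mapZ dL) (der_leibniz dD xd xd) dx.
rewrite (linear_mapZ (cbr_linear_l _)) (linear_mapZ (cbr_linear_r _)) xxx xxx0.
by rewrite oppr0 !scaler0 addr0 scaler0.
Qed.

Theorem theorem1 (B : nat -> rat) (B_bernoulli : bernoulli B) :
  exists d : complete -> complete,
    [/\ unique (fun d' => [/\ is_dgla cdeg cbr d', flat cbr d' ca, flat cbr d' cb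
                            & flow_moves d' ce ca cb]) d,
        d ca = - (1 / 2%:R : rat) *: cbr ca ca,
        d cb = - (1 / 2%:R : rat) *: cbr cb cb,
        (exists2 s : complete,
           infinite_sum (fun i => (B i / i`!%:R) *: iter i (cbr ce) (cb - ca)) s
         & d ce = cbr ce cb + s)
      & forall d' : complete -> complete, is_derivation cdeg cbr d' ->
          d' ca = d ca -> d' cb = d cb -> d' ce = d ce -> d' = d].
Proof.
pose v := diff_gen B; pose d := cder (diff_gen_deg B).
have dD : is_derivation cdeg cbr d by exact: cder_derivation.
have [da db de] : [/\ d ca = v Gen_a, d cb = v Gen_b & d ce = v Gen_e].
  split; first exact: (cder_gen _ Gen_a).
    exact: (cder_gen _ Gen_b).
  exact: (cder_gen _ Gen_e).
have d_unique d' : is_derivation cdeg cbr d' ->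
    d' ca = d ca -> d' cb = d cb -> d' ce = d ce -> d' = d.
  by move=> d'D ea eb ee; apply: derivation_determined => //; case.
have [flat_a flat_b] : flat cbr d ca /\ flat cbr d cb by rewrite !flatE.
have flow := (flow_equation B_bernoulli ca cb (d ce)).2 de.
have dd0 x : d (d x) = 0.
  apply: (derivation_square dD) x => -[].
  - exact: flat_square dD ca_deg flat_a.
  - exact: flat_square dD cb_deg flat_b.
  - apply: (ps_act_phiN_inj B_bernoulli); rewrite (linear_eq0 (ps_act_linear _)).
    apply: (flat_flow_square dD ca_deg _ flow flat_a flat_b) => n y z.
    exact: cseries_op_local.
exists d; split=> //.
- split=> [|d' [[_ d'D _] fa fb fl]].
    by split=> //; [split=> //; exact: complete_graded_lie | apply/flow_moves_e].
  apply/esym/d_unique => //.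
  + by rewrite da; apply/flatE.
  + by rewrite db; apply/flatE.
  + by rewrite de; apply/(flow_equation B_bernoulli)/flow_moves_e.
- by exists (ps_act (ps_bernoulli B) (cb - ca)); first exact: ps_act_sum.
Qed.
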